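(* Let $(M,g,J)$ be a Hermitian manifold of real dimension $2n$ and let $E$ be a Chern-Dirac bundle over $M$, with Clifford multiplication $c$ and covariant derivative $D$. Then the partial Chern-Dirac operators of $E$ satisfy $$({\not\!\partial}')^2=\mathcal R^{2,0},\qquad({\not\!\partial}'')^2=\mathcal R^{0,2},$$ where, for a section $\sigma$ of $E$ and the normalized complex frame $(\epsilon_j,\bar\epsilon_j)$ associated with a unitary frame, $\mathcal R^{2,0}\sigma=\sum_{j<k}c(\bar\epsilon_j\cdot\bar\epsilon_k)R_{\epsilon_j\epsilon_k}\sigma$ and $\mathcal R^{0,2}\sigma=\sum_{j<k}c(\epsilon_j\cdot\epsilon_k)R_{\bar\epsilon_j\bar\epsilon_k}\sigma$, and $R_{XY}=D_XD_Y-D_YD_X-D_{[X,Y]}$ is the curvature of $D$ (extended complex bilinearly in $X,Y$).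
   Context: $(M,g,J)$ is a Hermitian manifold of real dimension $2n$ ($J$ integrable, $g$ a $J$-invariant Riemannian metric); $g$ is extended complex bilinearly to $T^{\mathbb C}M$. $D^{\mathcal C}$ is the Chern connection: the unique connection with $D^{\mathcal C}g=0$, $D^{\mathcal C}J=0$ whose torsion $T(X,Y)=D^{\mathcal C}_XY-D^{\mathcal C}_YX-[X,Y]$ satisfies $T(JX,Y)=T(X,JY)$. A unitary frame is a $g$-orthonormal frame $(e_1,\dots,e_{2n})$ with $Je_{2j-1}=e_{2j}$; its associated normalized complex frame is $\epsilon_s=\frac{e_{2s-1}-ie_{2s}}{\sqrt2}$, $\bar\epsilon_s=\frac{e_{2s-1}+ie_{2s}}{\sqrt2}$, $1\le s\le n$. Put $T_{rs}=T(\epsilon_r,\epsilon_s)$, $T_{\bar r\bar s}=T(\bar\epsilon_r,\bar\epsilon_s)$. $\mathcal C\ell^{\mathbb C}M$ is the bundle of complex Clifford algebras of $(TM,g)$ with $v\cdot w+w\cdot v=-2g(v,w)$, endowed with the covariant derivative induced by $D^{\mathcal C}$. A Chern-Dirac bundle over $(M,g,J)$ is a complex vector bundle $E\to M$ with a Hermitian metric $h$, a covariant derivative $D$ preserving $h$, and a structure of complex left $\mathcal C\ell^{\mathbb C}M$-module $c:\mathcal C\ell^{\mathbb C}M\to\mathfrak{gl}(E)$ such that: (i) $h(c(v)\sigma_1,\sigma_2)+h(\sigma_1,c(\bar v)\sigma_2)=0$ for all $v\in T^{\mathbb C}M$, $\sigma_1,\sigma_2\in E$ (over the same point); (ii) $D_X(c(w)\sigma)=c(D^{\mathcal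 C}_Xw)\sigma+c(w)D_X\sigma$ for all vector fields $X$ and sections $w$ of $\mathcal C\ell^{\mathbb C}M$, $\sigma$ of $E$. Covariant derivatives are extended complex linearly to complex vector fields. The partial Chern-Dirac operators of $E$ are $${\not\!\partial}'\sigma=\sum_{j=1}^nc(\bar\epsilon_j)D_{\epsilon_j}\sigma-\tfrac12\sum_{r<s}c(\bar\epsilon_r\cdot\bar\epsilon_s\cdot T_{rs})\sigma,\qquad {\not\!\partial}''\sigma=\sum_{j=1}^nc(\epsilon_j)D_{\bar\epsilon_j}\sigma-\tfrac12\sum_{r<s}c(\epsilon_r\cdot\epsilon_s\cdot T_{\bar r\bar s})\sigma,$$ which do not depend on the choice of unitary frame. *)

(* Defs.v *)
(* Built on MathComp-Analysis and the complex numbers of mathcomp-real-closed. *)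
From HB Require Import structures.
From mathcomp Require Import all_boot all_order all_algebra.
From mathcomp Require Import all_classical all_reals all_analysis.
From mathcomp Require Import complex.

Set Implicit Arguments.
Unset Strict Implicit.
Unset Printing Implicit Defensive.

Import Order.TTheory GRing.Theory Num.Theory.
Import numFieldNormedType.Exports.

Local Open Scope classical_set_scope.
Local Open Scope ring_scope.
Local Open Scope complex_scope.

Section Manifolds.
Context {R : realType}.

(* Functions are total; [Ck k A f] is only meant for an open set [A], outside
   of which the values of [f] are irrelevant. *)
Fixpoint Ck (m k : nat) (A : set 'rV[R]_m) (f : 'rV[R]_m -> R) : Prop :=
  (forall x, A x -> {for x, continuous f}) /\
  match k with
  | 0 => True
  | k'.+1 => forall i : 'I_m,
      (forall x, A x -> derivable f x (delta_mx 0 i)) /\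
      Ck k' A (fun x => 'D_(delta_mx 0 i) f x)
  end.

Definition Cinfty (m : nat) (A : set 'rV[R]_m) (f : 'rV[R]_m -> R) : Prop :=
  forall k, Ck k A f.

Record chart (M : topologicalType) (m : nat) := Chart {
  cdom : set M;
  cmap : M -> 'rV[R]_m;
  cinv : 'rV[R]_m -> M;
  cdom_open : open cdom;
  cimg_open : open (cmap @` cdom);
  cmapK : forall p, cdom p -> cinv (cmap p) = p;
  cmap_cont : forall p, cdom p -> {for p, continuous cmap};
  cinv_cont : forall x, (cmap @` cdom) x -> {for x, continuous cinv} }.

Record manifold (m : nat) := Manifold {
  mcarrier :> topologicalType;
  matlas : set (chart mcarrier m);
  mhausdorff : hausdorff_space mcarrier;
  mcountable : @second_countable mcarrier;
  matlas_cover : forall p, exists2 phi, matlas phi & cdom phi p;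
  matlas_compat : forall phi psi, matlas phi -> matlas psi ->
    forall i : 'I_m,
      Cinfty (cmap phi @` (cdom phi `&` cdom psi))
             (fun x => cmap psi (cinv phi x) 0 i) }.

Context {m : nat} {M : manifold m}.

Definition smooth_on (U : set M) (f : M -> R) : Prop :=
  forall phi, matlas phi ->
    Cinfty (cmap phi @` (U `&` cdom phi)) (f \o cinv phi).

Definition smooth_near (p : M) (f : M -> R) : Prop :=
  exists2 U, open_nbhs p U & smooth_on U f.

(* The last clause makes the extension of a derivation of the algebra of germs
   at [p] to arbitrary functions unique. *)
Definition is_derivation (p : M) (v : (M -> R) -> R) : Prop :=
  [/\ forall (a : R) f g, smooth_near p f -> smooth_near p g ->
        v (fun q => a * f q + g q) = a * v f + v g,
      forall f g, smooth_near p f -> smooth_near p g ->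
        v (fun q => f q * g q) = f p * v g + g p * v f,
      forall f g, smooth_near p f -> smooth_near p g ->
        (\forall q \near p, f q = g q) -> v f = v g
    & forall f, ~ smooth_near p f -> v f = 0].

Definition derivations (p : M) : {pred ((M -> R) -> R)} :=
  [pred v | `[< is_derivation p v >]].

Lemma derivations_submod (p : M) : submod_closed (derivations p).
Proof.
split=> [|a v w /asboolP[v1 v2 v3 v4] /asboolP[w1 w2 w3 w4]]; apply/asboolP.
- have E f : (0 : (M -> R) -> R) f = 0 by [].
  by split=> // *; rewrite !E !mulr0 addr0.
- have E f : (a *: v + w) f = a * v f + w f by [].
  split=> [b f g sf sg|f g sf sg|f g sf sg fg|f nf]; rewrite !E.
  + by rewrite v1// w1// !mulrDr !addrA (mulrCA a b) (addrAC _ (a * v g)).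
  + by rewrite v2// w2// !mulrDr !addrA (mulrCA a) (mulrCA a)
      (addrAC _ _ (f p * w g)).
  + by rewrite (v3 f g)// (w3 f g).
  + by rewrite v4// w4// mulr0 addr0.
Qed.

HB.instance Definition _ (p : M) :=
  GRing.isSubmodClosed.Build R ((M -> R) -> R) (derivations p)
    (derivations_submod p).

Record tangent (p : M) := Tangent {
  tval :> (M -> R) -> R;
  tvalP : tval \in derivations p }.

HB.instance Definition _ (p : M) := [isSub for @tval p].
HB.instance Definition _ (p : M) := [Choice of tangent p by <:].
HB.instance Definition _ (p : M) :=
  [SubChoice_isSubLmodule of tangent p by <:].

Definition vfield := forall p : M, tangent p.

Definition smooth_vf (U : set M) (X : vfield) : Prop :=
  forall V f, open V -> V `<=` U -> smooth_on V f ->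
    smooth_on V (fun p => X p f).

(* [insub] always succeeds at points near which [X] and [Y] are smooth. *)
Definition bracket (X Y : vfield) : vfield := fun p =>
  odflt 0 (insub (fun f =>
    if `[< smooth_near p f >] then
      X p (fun q => Y q f) - Y p (fun q => X q f)
    else 0)).

(* A covariant derivative [D] is a rule [D p v X], for [v] a tangent vector at
   [p], acting on fields which are smooth near [p]; the values on other fields
   are irrelevant. *)
Definition tconnection := forall p : M, tangent p -> vfield -> tangent p.

Record is_tconnection (D : tconnection) : Prop := IsTConnection {
  tconn_lin : forall (U : set M) (X : vfield) p, open U -> U p ->
    smooth_vf U X -> forall (a : R) (v w : tangent p),
    D p (a *: v + w) X = a *: D p v X + D p w X;
  tconn_add : forall (U : set M) (X Y : vfield) p, open U -> U p ->
    smooth_vf U X -> smooth_vf U Y -> forall v : tangent p,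
    D p v (fun q => X q + Y q) = D p v X + D p v Y;
  tconn_leibniz : forall (U : set M) (f : M -> R) (X : vfield) p,
    open U -> U p -> smooth_on U f -> smooth_vf U X -> forall v : tangent p,
    D p v (fun q => f q *: X q) = v f *: X p + f p *: D p v X;
  tconn_local : forall (U : set M) (X Y : vfield) p, open U -> U p ->
    smooth_vf U X -> smooth_vf U Y -> (forall q, U q -> X q = Y q) ->
    forall v : tangent p, D p v X = D p v Y;
  tconn_smooth : forall (U : set M) (X Y : vfield), open U ->
    smooth_vf U X -> smooth_vf U Y -> smooth_vf U (fun p => D p (X p) Y) }.

Definition torsion (D : tconnection) (X Y : vfield) : vfield := fun p =>
  D p (X p) Y - D p (Y p) X - bracket X Y p.

Definition csmooth_on (U : set M) (f : M -> R[i]) : Prop :=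
  smooth_on U (fun p => complex.Re (f p)) /\
  smooth_on U (fun p => complex.Im (f p)).

Definition cderiv (p : M) (v : tangent p) (f : M -> R[i]) : R[i] :=
  (v (fun q => complex.Re (f q))) +i* (v (fun q => complex.Im (f q))).

Record trivialization (E : M -> lmodType R[i]) (r : nat) := Trivialization {
  tdom : set M;
  tmap : forall p, E p -> 'rV[R[i]]_r;
  tdom_open : open tdom;
  tmap_lin : forall p, tdom p -> forall (a : R[i]) (x y : E p),
    tmap (a *: x + y) = a *: tmap x + tmap y;
  tmap_bij : forall p, tdom p -> bijective (@tmap p) }.

Record vbundle := VBundle {
  fiber :> M -> lmodType R[i];
  vrank : nat;
  vtriv : set (trivialization fiber vrank);
  vtriv_cover : forall p, exists2 t, vtriv t & tdom t p;
  vtriv_compat : forall s t, vtriv s -> vtriv t ->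
    exists A : M -> 'M[R[i]]_vrank,
      (forall i j, csmooth_on (tdom s `&` tdom t) (fun p => A p i j)) /\
      (forall p, tdom s p -> tdom t p -> forall x : fiber p,
         tmap t x = tmap s x *m A p) }.

Definition section (E : M -> lmodType R[i]) := forall p, E p.

Definition smooth_sec (E : vbundle) (U : set M) (s : section E) : Prop :=
  forall t, vtriv t -> forall i,
    csmooth_on (U `&` tdom t) (fun p => tmap t (s p) 0 i).

Definition connection (E : M -> lmodType R[i]) :=
  forall p : M, tangent p -> section E -> E p.

(* [sm] is the notion of smoothness for sections of the bundle [E]. *)
Record is_connection (E : M -> lmodType R[i])
    (sm : set M -> section E -> Prop) (D : connection E) : Prop :=
  IsConnection {
  conn_lin : forall (U : set M) (s : section E) p, open U -> U p ->
    sm U s -> forall (a : R) (v w : tangent p),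
    D p (a *: v + w) s = a%:C *: D p v s + D p w s;
  conn_add : forall (U : set M) (s t : section E) p, open U -> U p ->
    sm U s -> sm U t -> forall v : tangent p,
    D p v (fun q => s q + t q) = D p v s + D p v t;
  conn_leibniz : forall (U : set M) (f : M -> R[i]) (s : section E) p,
    open U -> U p -> csmooth_on U f -> sm U s -> forall v : tangent p,
    D p v (fun q => f q *: s q) = cderiv v f *: s p + f p *: D p v s;
  conn_local : forall (U : set M) (s t : section E) p, open U -> U p ->
    sm U s -> sm U t -> (forall q, U q -> s q = t q) ->
    forall v : tangent p, D p v s = D p v t;
  conn_smooth : forall (U : set M) (X : vfield) (s : section E), open U ->
    smooth_vf U X -> sm U s -> sm U (fun p => D p (X p) s) }.

Record is_hermitian_metric (E : vbundle) (h : forall p, E p -> E p -> R[i]) :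
    Prop := IsHermitianMetric {
  hm_lin : forall p (a : R[i]) (x y z : E p),
    h p (a *: x + y) z = a * h p x z + h p y z;
  hm_conj : forall p (x y : E p), h p y x = (h p x y)^*;
  hm_pos : forall p (x : E p), x != 0 -> 0 < h p x x;
  hm_smooth : forall (U : set M) (s t : section E), open U ->
    smooth_sec U s -> smooth_sec U t ->
    csmooth_on U (fun p => h p (s p) (t p)) }.

End Manifolds.

Arguments manifold : clear implicits.
Arguments vfield {R m} M.
Arguments tconnection {R m} M.
Arguments vbundle {R m} M.

Record hermitian_manifold (R : realType) (n : nat) := HermitianManifold {
  hmanifold :> manifold R n.*2;
  hmetric : forall p : hmanifold, tangent p -> tangent p -> R;
  hJ : forall p : hmanifold, tangent p -> tangent p;
  hmetric_lin : forall p (a : R) (x y z : tangent p),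
    hmetric (a *: x + y) z = a * hmetric x z + hmetric y z;
  hmetric_sym : forall p (x y : tangent p), hmetric x y = hmetric y x;
  hmetric_pos : forall p (x : tangent p), x != 0 -> 0 < hmetric x x;
  hmetric_smooth : forall (U : set hmanifold) (X Y : vfield hmanifold),
    open U -> smooth_vf U X -> smooth_vf U Y ->
    smooth_on U (fun p => hmetric (X p) (Y p));
  hJ_lin : forall p (a : R) (x y : tangent p),
    hJ (a *: x + y) = a *: hJ x + hJ y;
  hJ_sq : forall p (x : tangent p), hJ (hJ x) = - x;
  hJ_smooth : forall (U : set hmanifold) (X : vfield hmanifold), open U ->
    smooth_vf U X -> smooth_vf U (fun p => hJ (X p));
  (* integrability: the Nijenhuis tensor vanishes *)
  hJ_integrable : forall (U : set hmanifold) (X Y : vfield hmanifold) p,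
    open U -> U p -> smooth_vf U X -> smooth_vf U Y ->
    bracket (fun q => hJ (X q)) (fun q => hJ (Y q)) p
      - hJ (bracket (fun q => hJ (X q)) Y p)
      - hJ (bracket X (fun q => hJ (Y q)) p) - bracket X Y p = 0;
  hmetric_J : forall p (x y : tangent p),
    hmetric (hJ x) (hJ y) = hmetric x y }.

Section HermitianManifolds.
Context {R : realType} {n : nat} {M : hermitian_manifold R n}.

Record is_chern (D : tconnection M) : Prop := IsChern {
  chern_conn : is_tconnection D;
  chern_metric : forall (U : set M) (X Y : vfield M) p, open U -> U p ->
    smooth_vf U X -> smooth_vf U Y -> forall v : tangent p,
    v (fun q => hmetric (X q) (Y q)) =
      hmetric (D p v X) (Y p) + hmetric (X p) (D p v Y);
  chern_J : forall (U : set M) (X : vfield M) p, open U -> U p ->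
    smooth_vf U X -> forall v : tangent p,
    D p v (fun q => hJ (X q)) = hJ (D p v X);
  chern_torsion : forall (U : set M) (X Y : vfield M) p, open U -> U p ->
    smooth_vf U X -> smooth_vf U Y ->
    torsion D (fun q => hJ (X q)) Y p = torsion D X (fun q => hJ (Y q)) p }.

(* [e j false] and [e j true], for [j] from 0 to [n - 1], are the members of
   index [2 j + 1] and [2 j + 2] of a frame whose indices start at 1. *)
Definition frame := 'I_n -> bool -> vfield M.

Record unitary_frame (U : set M) (e : frame) : Prop := UnitaryFrame {
  uframe_smooth : forall j b, smooth_vf U (e j b);
  uframe_orthonormal : forall p, U p -> forall j b k c,
    hmetric (e j b p) (e k c p) = ((j == k) && (b == c))%:R;
  uframe_span : forall p, U p -> forall v : tangent p,
    exists a : 'I_n -> bool -> R, v = \sum_j \sum_b a j b *: e j b p;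
  uframe_J : forall p, U p -> forall j, hJ (e j false p) = e j true p }.

(* The pair (x, y) stands for the complex tangent vector x + i y. *)
Definition ctangent (p : M) : Type := (tangent p * tangent p)%type.

Definition cvfield := forall p : M, ctangent p.

Definition cconj (p : M) (z : ctangent p) : ctangent p := (z.1, - z.2).

Definition re_vf (Z : cvfield) : vfield M := fun p => (Z p).1.
Definition im_vf (Z : cvfield) : vfield M := fun p => (Z p).2.

Definition eps (e : frame) (s : 'I_n) : cvfield := fun p =>
  (Num.sqrt 2)^-1 *: ((e s false p, - e s true p) : tangent p * tangent p).

Definition eps_bar (e : frame) (s : 'I_n) : cvfield := fun p =>
  (Num.sqrt 2)^-1 *: ((e s false p, e s true p) : tangent p * tangent p).

Definition ctorsion (D : tconnection M) (Z W : cvfield) : cvfield := fun p =>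
  (torsion D (re_vf Z) (re_vf W) p - torsion D (im_vf Z) (im_vf W) p,
   torsion D (re_vf Z) (im_vf W) p + torsion D (im_vf Z) (re_vf W) p).

Definition clifford_map (p : M) (A : algType R[i]) (f : tangent p -> A) : Prop :=
  (forall (a : R) v w, f (a *: v + w) = a%:C *: f v + f w) /\
  (forall v w, f v * f w + f w * f v = (- 2 * hmetric v w)%:C%:A).

(* The fibre at [p] is a complex Clifford algebra of [(T_p M, g_p)], i.e. it
   satisfies the universal property. *)
Record clifford_bundle := CliffordBundle {
  cl_fiber :> M -> algType R[i];
  cl_in : forall p, tangent p -> cl_fiber p;
  cl_inP : forall p, clifford_map (@cl_in p);
  cl_univ : forall p (A : algType R[i]) (f : tangent p -> A),
    clifford_map f ->
    exists phi : {lrmorphism cl_fiber p -> A},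
      (forall v, phi (cl_in v) = f v) /\
      (forall psi : {lrmorphism cl_fiber p -> A},
         (forall v, psi (cl_in v) = f v) -> psi =1 phi) }.

Definition cl_section (Cl : clifford_bundle) := forall p : M, Cl p.

Definition cl_connection (Cl : clifford_bundle) :=
  forall p : M, tangent p -> cl_section Cl -> Cl p.

Context {Cl : clifford_bundle}.

Definition cl_inC (p : M) (z : ctangent p) : Cl p :=
  cl_in Cl z.1 + 'i *: cl_in Cl z.2.

(* Locally, a smooth section is a combination, with smooth coefficients, of
   products of smooth vector fields. *)
Definition smooth_cl (U : set M) (w : cl_section Cl) : Prop :=
  forall p, U p -> exists V : set M, [/\ open V, V p, V `<=` U &
    exists (k : nat) (f : 'I_k -> M -> R[i]) (d : 'I_k -> nat)
        (X : 'I_k -> nat -> vfield M),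
      [/\ forall i, csmooth_on V (f i),
          forall i j, smooth_vf V (X i j)
        & forall q, V q ->
            w q = \sum_(i < k) f i q *: \prod_(j < d i) cl_in Cl (X i j q)]].

(* The extension of a connection of the tangent bundle to the Clifford bundle
   as a derivation. *)
Record is_induced (D : tconnection M) (DCl : cl_connection Cl) : Prop := IsInduced {
  induced_conn : @is_connection _ _ _ (fun p => Cl p : lmodType R[i]) smooth_cl DCl;
  induced_vf : forall (U : set M) (X : vfield M) p, open U -> U p ->
    smooth_vf U X -> forall v : tangent p,
    DCl p v (fun q => cl_in Cl (X q)) = cl_in Cl (D p v X);
  induced_mul : forall (U : set M) (w1 w2 : cl_section Cl) p, open U -> U p ->
    smooth_cl U w1 -> smooth_cl U w2 -> forall v : tangent p,
    DCl p v (fun q => w1 q * w2 q) = DCl p v w1 * w2 p + w1 p * DCl p v w2 }.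

Record chern_dirac_bundle (DCl : cl_connection Cl) := ChernDiracBundle {
  cd_bundle :> vbundle M;
  cd_h : forall p, cd_bundle p -> cd_bundle p -> R[i];
  cd_D : connection cd_bundle;
  cd_c : forall p, Cl p -> cd_bundle p -> cd_bundle p;
  cd_hermitian : is_hermitian_metric cd_h;
  cd_connection : is_connection (@smooth_sec _ _ _ cd_bundle) cd_D;
  cd_metric : forall (U : set M) (s t : section cd_bundle) p, open U -> U p ->
    smooth_sec U s -> smooth_sec U t -> forall v : tangent p,
    cderiv v (fun q => cd_h (s q) (t q)) =
      cd_h (cd_D v s) (t p) + cd_h (s p) (cd_D v t);
  cd_c_linl : forall p (a : R[i]) (u w : Cl p) (x : cd_bundle p),
    cd_c (a *: u + w) x = a *: cd_c u x + cd_c w x;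
  cd_c_linr : forall p (a : R[i]) (w : Cl p) (x y : cd_bundle p),
    cd_c w (a *: x + y) = a *: cd_c w x + cd_c w y;
  cd_c_one : forall p (x : cd_bundle p), cd_c 1 x = x;
  cd_c_mul : forall p (u w : Cl p) (x : cd_bundle p),
    cd_c (u * w) x = cd_c u (cd_c w x);
  cd_c_smooth : forall (U : set M) (w : cl_section Cl) (s : section cd_bundle),
    open U -> smooth_cl U w -> smooth_sec U s ->
    smooth_sec U (fun p => cd_c (w p) (s p));
  cd_c_skew : forall p (v : ctangent p) (x y : cd_bundle p),
    cd_h (cd_c (cl_inC v) x) y + cd_h x (cd_c (cl_inC (cconj v)) y) = 0;
  cd_c_parallel : forall (U : set M) (X : vfield M) (w : cl_section Cl)
    (s : section cd_bundle) p, open U -> U p ->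
    smooth_vf U X -> smooth_cl U w -> smooth_sec U s ->
    cd_D (X p) (fun q => cd_c (w q) (s q)) =
      cd_c (DCl p (X p) w) (s p) + cd_c (w p) (cd_D (X p) s) }.

Section PartialDirac.
Context {DCl : cl_connection Cl}.
Variables (D : tconnection M) (E : chern_dirac_bundle DCl).

Definition cd_DC (p : M) (z : ctangent p) (s : section E) : E p :=
  cd_D z.1 s + 'i *: cd_D z.2 s.

Definition curvature (X Y : vfield M) (s : section E) : section E := fun p =>
  cd_D (X p) (fun q => cd_D (Y q) s) - cd_D (Y p) (fun q => cd_D (X q) s)
    - cd_D (bracket X Y p) s.

Definition ccurvature (Z W : cvfield) (s : section E) : section E := fun p =>
  curvature (re_vf Z) (re_vf W) s p - curvature (im_vf Z) (im_vf W) s p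
  + 'i *: (curvature (re_vf Z) (im_vf W) s p
           + curvature (im_vf Z) (re_vf W) s p).

Definition dirac_frame' (e : frame) (s : section E) : section E := fun p =>
  \sum_(j < n) cd_c (cl_inC (eps_bar e j p)) (cd_DC (eps e j p) s)
  - 2^-1 *: \sum_(q < n) \sum_(r < n | (q < r)%N)
      cd_c (cl_inC (eps_bar e q p) * cl_inC (eps_bar e r p)
            * cl_inC (ctorsion D (eps e q) (eps e r) p)) (s p).

Definition dirac_frame'' (e : frame) (s : section E) : section E := fun p =>
  \sum_(j < n) cd_c (cl_inC (eps e j p)) (cd_DC (eps_bar e j p) s)
  - 2^-1 *: \sum_(q < n) \sum_(r < n | (q < r)%N)
      cd_c (cl_inC (eps e q p) * cl_inC (eps e r p)
            * cl_inC (ctorsion D (eps_bar e q) (eps_bar e r) p)) (s p).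

(* The value at [p] is computed in some unitary frame defined near [p]; it does
   not depend on which one. *)
Definition partial_dirac' (s : section E) : section E := fun p =>
  xget 0 [set x | exists U e, [/\ open U, U p, unitary_frame U e &
                               x = dirac_frame' e s p]].

Definition partial_dirac'' (s : section E) : section E := fun p =>
  xget 0 [set x | exists U e, [/\ open U, U p, unitary_frame U e &
                               x = dirac_frame'' e s p]].

Definition R20 (e : frame) (s : section E) : section E := fun p =>
  \sum_(j < n) \sum_(k < n | (j < k)%N)
    cd_c (cl_inC (eps_bar e j p) * cl_inC (eps_bar e k p))
         (ccurvature (eps e j) (eps e k) s p).

Definition R02 (e : frame) (s : section E) : section E := fun p =>
  \sum_(j < n) \sum_(k < n | (j < k)%N)
    cd_c (cl_inC (eps e j p) * cl_inC (eps e k p))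
         (ccurvature (eps_bar e j) (eps_bar e k) s p).

End PartialDirac.
End HermitianManifolds.

Arguments tconnection {R m} M.
Arguments frame {R n} M.
Arguments clifford_bundle {R n} M.

(* Main.v *)
(* Replacing J by -J exchanges the two operators, so only the first has to be
   treated.  In a unitary frame write
   a_j = c(conj eps_j), b_v = c(v) for v of type (1,0) and N_j = D_{eps_j}, so that
   the operator is A - theta, with A = sum_j a_j N_j and
   theta = (1/4) sum a_q a_r b_{T_qr}.
   Metricity, D J = 0 and the Clifford relations give
   A^2 = R^{2,0} - sum_{j<k} a_j a_k D_{T_jk}, and the last sum cancels against the
   first-order part of A theta + theta A.  There remains
   theta^2 = sum_j a_j (N_j theta), which by the Clifford relations is the first
   Bianchi identity for the torsion on (1,0)-vectors, without curvature term:
   the (0,1)-part of the Chern connection is given by brackets, hence flat by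
   the Jacobi identity, so the (0,2)- and, by skewness, the (2,0)-part of its
   curvature vanish.
   Complex vectors are encoded by real vectors v, the (1,0)- and (0,1)-vectors
   being z10 v = (v - i J v) / sqrt 2 and
   z01 v = (v + i J v) / sqrt 2. *)
From HB Require Import structures.
Require Import Defs.
From mathcomp Require Import all_boot all_order all_algebra.
From mathcomp Require Import all_classical all_reals all_analysis.
From mathcomp Require Import complex ring.

Set Implicit Arguments.
Unset Strict Implicit.
Unset Printing Implicit Defensive.

Import Order.TTheory GRing.Theory Num.Theory.
Import numFieldNormedType.Exports.

Local Open Scope classical_set_scope.
Local Open Scope ring_scope.

(** * Smooth functions *)

Section SmoothFunctions.
Context {R : realType}.

(** The operators are defined point by point, through a frame chosen near each point, and have to be
    applied twice. So independence of the frame comes before the square: on a whole neighbourhood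
    the chosen values are those of one fixed frame, hence form a smooth section that can be
    differentiated again. The frame is arbitrary, so its connection coefficients stay in the
    computation. By metricity those of the conjugate frame are minus the transposed ones, which lets
    every coefficient be moved onto a (1,0)-vector; together with the brackets they recombine into
    torsion. The map [z10] is a complex isomorphism from the tangent space with [J] as
    multiplication by i onto the (1,0)-vectors, and this fixes the constants. Since T is complex
    bilinear for [J], T(z10 v, z10 w) = z10 (sqrt 2 T(v, w)); by integrability [z10 X, z10 Y] = z10
    (([X, Y] - [JX, JY]) / sqrt 2). The 1/4 in theta is the 1/2 of the definition times the 1/2 of
    summing over all ordered pairs. *)

Lemma Ck_sub (m k : nat) (A B : set 'rV[R]_m) f :
  A `<=` B -> Ck k B f -> Ck k A f.
Proof.
move=> AB; elim: k f => [|k IH] f [cf df]; split=> //.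
- by move=> x /AB; exact: cf.
- by move=> x /AB; exact: cf.
- by move=> i; have [di Di] := df i; split=> [x /AB|]; [exact: di|exact: IH].
Qed.

Lemma eq_on_near (T : topologicalType) (S : Type) (A : set T) (f g : T -> S) x :
  open A -> A x -> {in A, f =1 g} -> \forall y \near x, f y = g y.
Proof.
move=> oA Ax fg; apply: filterS (open_nbhs_nbhs (conj oA Ax)) => y Ay.
by apply: fg; rewrite inE.
Qed.

(** Continuity and directional derivatives at a point depend only on the germ there, so on an open
    set they ignore the arbitrary outside values. This transfers the rules for derivatives, known
    only on [A], in [CkD] and [CkM]. *)
Lemma eq_Ck (m k : nat) (A : set 'rV[R]_m) f g : open A ->
  {in A, f =1 g} -> Ck k A f -> Ck k A g.
Proof.
move=> oA; elim: k f g => [|k IH] f g fg [cf df].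
  split=> // x Ax; have fgx : f x = g x by apply: fg; rewrite inE.
  rewrite /prop_for /continuous_at -fgx.
  exact: cvg_trans (near_eq_cvg (eq_on_near oA Ax fg)) (cf x Ax).
split=> [x Ax|i].
  have fgx : f x = g x by apply: fg; rewrite inE.
  rewrite /prop_for /continuous_at -fgx.
  exact: cvg_trans (near_eq_cvg (eq_on_near oA Ax fg)) (cf x Ax).
have [di Di] := df i; split=> [x Ax|].
  by apply: near_eq_derivable (di x Ax); exact: eq_on_near oA Ax fg.
apply: IH Di => x; rewrite inE => Ax.
by apply: near_eq_derive; exact: eq_on_near oA Ax fg.
Qed.

(** Needed for products: each term of the Leibniz rule keeps one factor undifferentiated, of class k
    + 1 where the induction asks for k. *)
Lemma Ck_prev (m k : nat) (A : set 'rV[R]_m) f : Ck k.+1 A f -> Ck k A f.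
Proof.
elim: k f => [|k IH] f [cf df]; split=> // i.
by have [di Di] := df i; split=> //; exact: IH.
Qed.

Lemma Ck_cst (m k : nat) (A : set 'rV[R]_m) (a : R) : Ck k A (fun=> a).
Proof.
elim: k a => [|k IH] a; split=> //; try by move=> x _; exact: cst_continuous.
move=> i; split=> [x _|]; first exact: derivable_cst.
have D0 : (fun x : 'rV[R]_m => 'D_(delta_mx 0 i) (fun=> a) x) = (fun=> 0).
  by apply: funext => x; exact: derive_cst.
by rewrite D0; exact: IH.
Qed.

Lemma CkD (m k : nat) (A : set 'rV[R]_m) f g : open A ->
  Ck k A f -> Ck k A g -> Ck k A (fun x => f x + g x).
Proof.
move=> oA; elim: k f g => [|k IH] f g [cf df] [cg dg].
  split=> // x Ax; exact: (cvgD (cf x Ax) (cg x Ax)).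
split=> [x Ax|i]; first exact: (cvgD (cf x Ax) (cg x Ax)).
have [di Di] := df i; have [ei Ei] := dg i.
split=> [x Ax|]; first by apply: derivableD; [exact: di|exact: ei].
apply: eq_Ck (IH _ _ Di Ei) => // x; rewrite inE => Ax.
by rewrite -deriveD; [|exact: di|exact: ei].
Qed.

Lemma CkM (m k : nat) (A : set 'rV[R]_m) f g : open A ->
  Ck k A f -> Ck k A g -> Ck k A (fun x => f x * g x).
Proof.
move=> oA; elim: k f g => [|k IH] f g Hf Hg.
  have [cf _] := Hf; have [cg _] := Hg.
  split=> // x Ax; exact: (cvgM (cf x Ax) (cg x Ax)).
have [cf df] := Hf; have [cg dg] := Hg.
split=> [x Ax|i]; first exact: (cvgM (cf x Ax) (cg x Ax)).
have [di Di] := df i; have [ei Ei] := dg i.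
split=> [x Ax|]; first by apply: derivableM; [exact: di|exact: ei].
apply: eq_Ck (CkD oA (IH _ _ (Ck_prev Hf) Ei) (IH _ _ (Ck_prev Hg) Di)) => //.
move=> x; rewrite inE => Ax.
by rewrite (deriveM (di x Ax) (ei x Ax)).
Qed.

Context {m : nat} {M : manifold R m}.
Implicit Types (U V : set M) (f g : M -> R).

(** A chart only provides the openness of its full image; continuity of [cinv] at a point of that
    image cuts it down to [U]. *)
Lemma chart_image_open (phi : @chart R M m) U :
  open U -> open (cmap phi @` (U `&` cdom phi)).
Proof.
move=> oU; rewrite openE => _ [p [Up dp] <-]; rewrite /interior.
have Ip : (cmap phi @` cdom phi) (cmap phi p) by exists p.
have nI := open_nbhs_nbhs (conj (@cimg_open _ _ _ phi) Ip).
have cI := cinv_cont Ip.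
have nU : nbhs (cmap phi p) (cinv phi @^-1` U).
  by apply: cI; rewrite cmapK//; exact: open_nbhs_nbhs.
apply: filterS (filterI nI nU) => _ [[q dq <-]].
by rewrite /preimage /= cmapK// => Uq; exists q.
Qed.

Lemma smooth_on_sub U V f : V `<=` U -> smooth_on U f -> smooth_on V f.
Proof.
move=> VU sf phi hphi k; apply: Ck_sub (sf phi hphi k).
by apply: image_subset; exact: setSI.
Qed.

Lemma eq_smooth_on U f g : open U -> (forall q, U q -> f q = g q) ->
  smooth_on U f -> smooth_on U g.
Proof.
move=> oU fg sf phi hphi k; apply: eq_Ck (sf phi hphi k).
  exact: chart_image_open.
by move=> x; rewrite inE => -[q [Uq dq] <-]; rewrite /= cmapK// fg.
Qed.

Lemma smooth_on_cst U (a : R) : smooth_on U (fun=> a).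
Proof. by move=> phi _ k; exact: Ck_cst. Qed.

Lemma smooth_onD U f g : open U -> smooth_on U f -> smooth_on U g ->
  smooth_on U (fun q => f q + g q).
Proof.
move=> oU sf sg phi hphi k.
have := CkD (chart_image_open oU) (sf phi hphi k) (sg phi hphi k).
by apply: eq_Ck => //; exact: chart_image_open.
Qed.

Lemma smooth_onM U f g : open U -> smooth_on U f -> smooth_on U g ->
  smooth_on U (fun q => f q * g q).
Proof.
move=> oU sf sg phi hphi k.
have := CkM (chart_image_open oU) (sf phi hphi k) (sg phi hphi k).
by apply: eq_Ck => //; exact: chart_image_open.
Qed.

Lemma smooth_onN U f : open U -> smooth_on U f -> smooth_on U (fun q => - f q).
Proof.
move=> oU sf; apply: eq_smooth_on (smooth_onM oU (smooth_on_cst U (- 1)) sf) => //.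
by move=> q _; rewrite mulN1r.
Qed.

Lemma smooth_onB U f g : open U -> smooth_on U f -> smooth_on U g ->
  smooth_on U (fun q => f q - g q).
Proof. by move=> oU sf sg; apply: smooth_onD => //; exact: smooth_onN. Qed.

Lemma smooth_on_near U f p : open U -> U p -> smooth_on U f -> smooth_near p f.
Proof. by move=> oU Up sf; exists U. Qed.

Lemma smooth_near_on U f p : open U -> U p -> smooth_near p f ->
  exists V, [/\ open V, V p, V `<=` U & smooth_on V f].
Proof.
move=> oU Up [W [oW Wp] sf]; exists (U `&` W); split=> //.
- exact: openI.
- exact: smooth_on_sub sf.
Qed.

End SmoothFunctions.

(** * Tangent vectors and brackets *)

Section TangentVectors.
Context {R : realType} {m : nat} {M : manifold R m}.
Implicit Types (U V : set M) (f g : M -> R) (X Y Z : vfield M) (p : M).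

Lemma tangentD p (v w : tangent p) f : (v + w) f = v f + w f.
Proof. by []. Qed.

Lemma tangentN p (v : tangent p) f : (- v) f = - v f.
Proof. by []. Qed.

Lemma tangentZ p (a : R) (v : tangent p) f : (a *: v) f = a * v f.
Proof. by []. Qed.

Lemma tangent_derivation p (v : tangent p) : is_derivation p v.
Proof. exact/asboolP/(tvalP v). Qed.

(** The last clause of [is_derivation] makes both vectors vanish on functions that are not smooth
    near [p]. *)
Lemma tangent_ext p (v w : tangent p) :
  (forall f, smooth_near p f -> v f = w f) -> v = w.
Proof.
move=> vw; apply/val_inj/funext => f.
have [_ _ _ v0] := tangent_derivation v; have [_ _ _ w0] := tangent_derivation w.
by have [/vw//|nf] := pselect (smooth_near p f); rewrite [LHS]v0// [RHS]w0.
Qed.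

Lemma smooth_near_cst p (a : R) : smooth_near p (fun _ : M => a).
Proof.
by exists setT; [split; [exact: openT|]|exact: smooth_on_cst].
Qed.

Lemma smooth_near2 p f g : smooth_near p f -> smooth_near p g ->
  exists U, [/\ open U, U p, smooth_on U f & smooth_on U g].
Proof.
move=> [U [oU Up] sf] [V [oV Vp] sg]; exists (U `&` V); split=> //.
- exact: openI.
- exact: smooth_on_sub sf.
- exact: smooth_on_sub sg.
Qed.

Lemma smooth_nearD p f g : smooth_near p f -> smooth_near p g ->
  smooth_near p (fun q => f q + g q).
Proof.
move=> sf sg; have [U [oU Up {}sf {}sg]] := smooth_near2 sf sg.
by apply: (smooth_on_near oU Up); exact: smooth_onD.
Qed.

Lemma smooth_nearM p f g : smooth_near p f -> smooth_near p g ->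
  smooth_near p (fun q => f q * g q).
Proof.
move=> sf sg; have [U [oU Up {}sf {}sg]] := smooth_near2 sf sg.
by apply: (smooth_on_near oU Up); exact: smooth_onM.
Qed.

Lemma smooth_nearN p f : smooth_near p f -> smooth_near p (fun q => - f q).
Proof.
by move=> [U [oU Up] sf]; apply: (smooth_on_near oU Up); exact: smooth_onN.
Qed.

Lemma eq_tangent p (v : tangent p) U f g : open U -> U p ->
  (forall q, U q -> f q = g q) -> smooth_near p f -> v f = v g.
Proof.
move=> oU Up fg sf; have [_ _ vloc _] := tangent_derivation v.
apply: vloc => //; last first.
  by apply: eq_on_near oU Up _ => q; rewrite inE; exact: fg.
have [V [oV Vp VU {}sf]] := smooth_near_on oU Up sf.
exists V => //; apply: eq_smooth_on sf => // q /VU; exact: fg.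
Qed.

Lemma tangent_add p (v : tangent p) f g : smooth_near p f -> smooth_near p g ->
  v (fun q => f q + g q) = v f + v g.
Proof.
move=> sf sg; have [vlin _ _ _] := tangent_derivation v.
rewrite -[v f]mul1r -vlin//; congr (v _); apply: funext => q.
by rewrite mul1r.
Qed.

Lemma tangent_mul p (v : tangent p) f g : smooth_near p f -> smooth_near p g ->
  v (fun q => f q * g q) = f p * v g + g p * v f.
Proof. by have [_ vM _ _] := tangent_derivation v; exact: vM. Qed.

Lemma tangent_cst p (v : tangent p) (a : R) : v (fun=> a) = 0.
Proof.
have [vlin vM _ _] := tangent_derivation v.
have c b := smooth_near_cst p b.
have v0 : v (fun=> 0) = 0.
  have := tangent_add v (c 0) (c 0).
  rewrite (_ : (fun=> _ + _) = fun=> 0); last by apply: funext => q; rewrite addr0.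
  by move/eqP; rewrite -subr_eq subrr eq_sym => /eqP.
have v1 : v (fun=> 1) = 0.
  have := vM _ _ (c 1) (c 1); rewrite !mul1r.
  by move/eqP; rewrite -subr_eq subrr eq_sym => /eqP.
by have := vlin a _ _ (c 1) (c 0); rewrite v1 v0 mulr0 !addr0 mulr1.
Qed.

Lemma tangent_opp p (v : tangent p) f : smooth_near p f ->
  v (fun q => - f q) = - v f.
Proof.
move=> sf; have := tangent_add v sf (smooth_nearN sf).
rewrite (_ : (fun q => f q - f q) = fun=> 0).
  by rewrite tangent_cst => /esym/eqP; rewrite addrC addr_eq0 => /eqP.
by apply: funext => q; rewrite subrr.
Qed.

Lemma tangent_sub p (v : tangent p) f g : smooth_near p f -> smooth_near p g ->
  v (fun q => f q - g q) = v f - v g.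
Proof.
by move=> sf sg; rewrite tangent_add ?tangent_opp//; exact: smooth_nearN.
Qed.

Lemma smooth_vf_sub U V X : V `<=` U -> smooth_vf U X -> smooth_vf V X.
Proof. by move=> VU sX W f oW WV; apply: sX => //; exact: subset_trans VU. Qed.

Lemma smooth_vf_near U X p f : open U -> U p -> smooth_vf U X ->
  smooth_near p f -> smooth_near p (fun q => X q f).
Proof.
move=> oU Up sX sf; have [V [oV Vp VU {}sf]] := smooth_near_on oU Up sf.
by exists V => //; exact: sX.
Qed.

Lemma eq_smooth_vf U X Y : (forall q, U q -> X q = Y q) ->
  smooth_vf U X -> smooth_vf U Y.
Proof.
move=> XY sX V f oV VU sf; apply: eq_smooth_on (sX V f oV VU sf) => // q /VU Uq.
by rewrite XY.
Qed.

Lemma smooth_vfD U X Y : smooth_vf U X -> smooth_vf U Y ->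
  smooth_vf U (fun q => X q + Y q).
Proof.
by move=> sX sY V f oV VU sf; apply: smooth_onD => //; [exact: sX|exact: sY].
Qed.

Lemma smooth_vfM U f X : smooth_on U f -> smooth_vf U X ->
  smooth_vf U (fun q => f q *: X q).
Proof.
move=> sf sX V g oV VU sg; apply: smooth_onM => //; last exact: sX.
exact: smooth_on_sub sf.
Qed.

Lemma smooth_vfZ U (a : R) X : smooth_vf U X -> smooth_vf U (fun q => a *: X q).
Proof. by apply: smooth_vfM; exact: smooth_on_cst. Qed.

Lemma smooth_vfN U X : smooth_vf U X -> smooth_vf U (fun q => - X q).
Proof.
move=> sX; apply: eq_smooth_vf (smooth_vfZ (-1) sX) => q _.
by rewrite scaleN1r.
Qed.

Lemma smooth_vfB U X Y : smooth_vf U X -> smooth_vf U Y ->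
  smooth_vf U (fun q => X q - Y q).
Proof. by move=> sX sY; apply: smooth_vfD => //; exact: smooth_vfN. Qed.

Lemma smooth_vf0 U : smooth_vf U (fun=> 0).
Proof. by move=> V f oV VU sf; exact: smooth_on_cst. Qed.

Lemma smooth_vf_sum U (I : Type) (r : seq I) (X : I -> vfield M) :
  (forall i, smooth_vf U (X i)) -> smooth_vf U (fun q => \sum_(i <- r) X i q).
Proof.
move=> sX; elim: r => [|i r IH].
  by apply: eq_smooth_vf (@smooth_vf0 U) => q _; rewrite big_nil.
by apply: eq_smooth_vf (smooth_vfD (sX i) IH) => q _; rewrite big_cons.
Qed.

(** The commutator of two smooth fields is a derivation, so [insub] succeeds and the default value 0
    of [bracket] is never taken. *)
Lemma bracketE U X Y p f : open U -> U p -> smooth_vf U X -> smooth_vf U Y ->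
  smooth_near p f ->
  bracket X Y p f = X p (fun q => Y q f) - Y p (fun q => X q f).
Proof.
move=> oU Up sX sY sf; rewrite /bracket.
case: insubP => [u _ uE|/negP nD]; first by rewrite /= [LHS](congr1 (@^~ f) uE) asboolT.
exfalso; apply: nD; apply/asboolP; clear f sf.
have nX := smooth_vf_near oU Up sX; have nY := smooth_vf_near oU Up sY.
have E (Z W : vfield M) f g (a : R) : smooth_vf U Z -> smooth_vf U W ->
    smooth_near p f -> smooth_near p g ->
    Z p (fun q => W q (fun q => a * f q + g q))
    = a * Z p (fun q => W q f) + Z p (fun q => W q g).
  move=> sZ sW sf sg.
  have nZ := smooth_vf_near oU Up sZ; have nW := smooth_vf_near oU Up sW.
  have [vlin _ _ _] := tangent_derivation (Z p); rewrite -vlin; [|exact: nW..].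
  have [V [oV Vp {}sf {}sg]] := smooth_near2 sf sg.
  apply: (@eq_tangent _ _ (U `&` V)) => //; first exact: openI.
    move=> q [Uq Vq]; have [wlin _ _ _] := tangent_derivation (W q).
    by rewrite wlin//; [exact: smooth_on_near sf|exact: smooth_on_near sg].
  apply: nW; apply: (smooth_on_near oV Vp); apply: smooth_onD => //.
  by apply: smooth_onM => //; exact: smooth_on_cst.
(* Besides the Leibniz terms, the second derivative of a product has the mixed terms W(g) Z(f) +
   W(f) Z(g). They are symmetric in the two fields and cancel in the commutator. *)
have EM (Z W : vfield M) f g : smooth_vf U Z -> smooth_vf U W ->
    smooth_near p f -> smooth_near p g ->
    Z p (fun q => W q (fun q => f q * g q))
    = f p * Z p (fun q => W q g) + W p g * Z p f
      + (g p * Z p (fun q => W q f) + W p f * Z p g).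
  move=> sZ sW sf sg.
  have nZ := smooth_vf_near oU Up sZ; have nW := smooth_vf_near oU Up sW.
  have := (nW _ sf, nW _ sg) => -[nWf nWg].
  rewrite -!tangent_mul// -tangent_add; [|exact: smooth_nearM..].
  have nfg := nW _ (smooth_nearM sf sg).
  have [V [oV Vp {}sf {}sg]] := smooth_near2 sf sg.
  apply: (@eq_tangent _ _ (U `&` V)) => //; first exact: openI.
  move=> q [Uq Vq].
  by rewrite tangent_mul//; [exact: smooth_on_near sf|exact: smooth_on_near sg].
split=> [a f g sf sg|f g sf sg|f g sf sg fg|f nf].
- rewrite !asboolT//; first by rewrite !E//; ring.
  apply: smooth_nearD => //; apply: smooth_nearM => //; exact: smooth_near_cst.
- by rewrite !asboolT//; [rewrite !EM//; ring|exact: smooth_nearM].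
- rewrite !asboolT//.
  (* The inner derivatives are taken at points near [p], so equality is needed on an open set: the
     interior of the set where [f] and [g] agree. *)
  have [V [oV Vp VU {}fg]] : exists V, [/\ open V, V p, V `<=` U &
      forall q, V q -> f q = g q].
    have nV := filterI (open_nbhs_nbhs (conj oU Up)) fg.
    have iV q : (U `&` [set q | f q = g q])^° q -> U q /\ f q = g q.
      by move=> /interior_subset.
    exists (U `&` [set q | f q = g q])^°; split; first exact: open_interior.
    - exact: nV.
    - by move=> q /iV [].
    - by move=> q /iV [].
  have EL (Z W : vfield M) : smooth_vf U Z -> smooth_vf U W ->
      Z p (fun q => W q f) = Z p (fun q => W q g).
    move=> sZ sW; have [V' [oV' Vp' {}sf {}sg]] := smooth_near2 sf sg.
    apply: (@eq_tangent _ _ (V `&` V')) => //; first exact: openI.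
      move=> q [Vq Vq']; apply: (@eq_tangent _ _ V) => //.
      exact: smooth_on_near sf.
    apply: (smooth_vf_near oU Up) => //; exact: smooth_on_near sf.
  by rewrite !(EL X Y, EL Y X).
- by rewrite asboolF.
Qed.

Lemma smooth_bracket U X Y : open U -> smooth_vf U X -> smooth_vf U Y ->
  smooth_vf U (bracket X Y).
Proof.
move=> oU sX sY V f oV VU sf.
apply: (@eq_smooth_on _ _ _ _
  (fun q => X q (fun r => Y r f) - Y q (fun r => X r f))) => //.
  by move=> q Vq; rewrite (bracketE oU) => //; [exact: VU|exact: smooth_on_near sf].
by apply: smooth_onB => //; [apply: sX => //; exact: sY|apply: sY => //; exact: sX].
Qed.

Lemma eq_bracket U X X' Y Y' p : open U -> U p ->
  smooth_vf U X -> smooth_vf U Y ->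
  (forall q, U q -> X q = X' q) -> (forall q, U q -> Y q = Y' q) ->
  bracket X Y p = bracket X' Y' p.
Proof.
move=> oU Up sX sY XX' YY'; apply: tangent_ext => f sf.
rewrite (bracketE oU)// (bracketE oU Up (eq_smooth_vf XX' sX) (eq_smooth_vf YY' sY))//.
rewrite -XX'// -YY'//; congr (_ - _); apply: (eq_tangent _ oU) => //.
- by move=> q Uq; rewrite YY'.
- exact: (smooth_vf_near oU).
- by move=> q Uq; rewrite XX'.
- exact: (smooth_vf_near oU).
Qed.

Lemma bracketC U X Y p : open U -> U p -> smooth_vf U X -> smooth_vf U Y ->
  bracket X Y p = - bracket Y X p.
Proof.
move=> oU Up sX sY; apply: tangent_ext => f sf.
by rewrite tangentN !(bracketE oU)// opprB.
Qed.

Lemma bracketDr U X Y Z p : open U -> U p ->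
  smooth_vf U X -> smooth_vf U Y -> smooth_vf U Z ->
  bracket X (fun q => Y q + Z q) p = bracket X Y p + bracket X Z p.
Proof.
move=> oU Up sX sY sZ; apply: tangent_ext => f sf.
rewrite tangentD !(bracketE oU)//; last exact: smooth_vfD.
rewrite !tangentD tangent_add ?opprD; [|exact: (smooth_vf_near oU)..].
by rewrite addrACA.
Qed.

Lemma bracketMr U X Y g p : open U -> U p ->
  smooth_vf U X -> smooth_vf U Y -> smooth_on U g ->
  bracket X (fun q => g q *: Y q) p = X p g *: Y p + g p *: bracket X Y p.
Proof.
move=> oU Up sX sY sg; apply: tangent_ext => f sf.
rewrite tangentD !tangentZ !(bracketE oU)//; last exact: smooth_vfM.
rewrite !tangentZ (_ : (fun q => _ f) = fun q => g q * Y q f)// tangent_mul.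
- by ring.
- exact: smooth_on_near sg.
- exact: (smooth_vf_near oU).
Qed.

Lemma bracketNr U X Y p : open U -> U p -> smooth_vf U X -> smooth_vf U Y ->
  bracket X (fun q => - Y q) p = - bracket X Y p.
Proof.
move=> oU Up sX sY; apply: tangent_ext => f sf.
rewrite tangentN !(bracketE oU)//; last exact: smooth_vfN.
by rewrite !tangentN tangent_opp ?opprD//; exact: (smooth_vf_near oU).
Qed.

Lemma bracketBr U X Y Z p : open U -> U p ->
  smooth_vf U X -> smooth_vf U Y -> smooth_vf U Z ->
  bracket X (fun q => Y q - Z q) p = bracket X Y p - bracket X Z p.
Proof.
move=> oU Up sX sY sZ; rewrite (bracketDr oU)//; last exact: smooth_vfN.
by rewrite (bracketNr oU).
Qed.

Lemma bracketBl U X Y Z p : open U -> U p ->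
  smooth_vf U X -> smooth_vf U Y -> smooth_vf U Z ->
  bracket (fun q => X q - Y q) Z p = bracket X Z p - bracket Y Z p.
Proof.
move=> oU Up sX sY sZ; rewrite (bracketC oU)//; last exact: smooth_vfB.
by rewrite (bracketBr oU)// opprB addrC (bracketC oU)// (bracketC oU Up sZ sY) opprK.
Qed.

(** All third-order terms cancel once both sides act on a function. The derivation form is the one
    in which the flatness of [dbar] will be recognised. *)
Lemma jacobi U X Y Z p : open U -> U p ->
  smooth_vf U X -> smooth_vf U Y -> smooth_vf U Z ->
  bracket X (bracket Y Z) p - bracket Y (bracket X Z) p
  = bracket (bracket X Y) Z p.
Proof.
move=> oU Up sX sY sZ; apply: tangent_ext => f sf.
have sXY := smooth_bracket oU sX sY; have sXZ := smooth_bracket oU sX sZ.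
have sYZ := smooth_bracket oU sY sZ.
rewrite tangentD tangentN !(bracketE oU)//; try exact: (smooth_vf_near oU).
have E (A B C : vfield M) : smooth_vf U A -> smooth_vf U B -> smooth_vf U C ->
    A p (fun q => bracket B C q f)
    = A p (fun q => B q (fun r => C r f)) - A p (fun q => C q (fun r => B r f)).
  move=> sA sB sC; have [V [oV Vp VU {}sf]] := smooth_near_on oU Up sf.
  rewrite -tangent_sub.
  - apply: (eq_tangent _ oV Vp) => [q Vq|].
      by rewrite (bracketE oU)//; [exact: VU|exact: smooth_on_near sf].
    by apply: (smooth_vf_near oU Up (smooth_bracket oU sB sC)); exists V.
  - by apply: (smooth_vf_near oU) => //; apply: (smooth_vf_near oU) => //; exists V.
  - by apply: (smooth_vf_near oU) => //; apply: (smooth_vf_near oU) => //; exists V.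
by rewrite !E//; ring.
Qed.

End TangentVectors.

(** * Linear identities in modules *)

Section LmodReflection.
Context {C : comNzRingType} {V : lmodType C}.

(** Syntax for a proof by reflection: both sides of a linear identity are compared atom by atom,
    which leaves only scalar equations. *)
Inductive lexpr :=
| LVar of nat | LZero | LAdd of lexpr & lexpr | LOpp of lexpr
| LScale of C & lexpr.

Fixpoint leval (env : seq V) (t : lexpr) : V :=
  match t with
  | LVar i => nth 0 env i
  | LZero => 0
  | LAdd t1 t2 => leval env t1 + leval env t2
  | LOpp t1 => - leval env t1
  | LScale c t1 => c *: leval env t1
  end.

(** [eqn] on numerals reduces under [cbn], so no index comparison survives in the scalar goals given
    to [ring]. *)
Fixpoint lcoef (t : lexpr) (i : nat) : C :=
  match t with
  | LVar j => if eqn i j then 1 else 0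
  | LZero => 0
  | LAdd t1 t2 => lcoef t1 i + lcoef t2 i
  | LOpp t1 => - lcoef t1 i
  | LScale c t1 => c * lcoef t1 i
  end.

Fixpoint lcoef_eq (k : nat) (t1 t2 : lexpr) : Prop :=
  match k with
  | 0 => True
  | k'.+1 => lcoef t1 k' = lcoef t2 k' /\ lcoef_eq k' t1 t2
  end.

Lemma leval_sum (env : seq V) t :
  leval env t = \sum_(i < size env) lcoef t i *: nth 0 env i.
Proof.
elim: t => [j||t1 IH1 t2 IH2|t1 IH|c t1 IH] /=; rewrite ?IH1 ?IH2 ?IH.
- have [jlt|jge] := ltnP j (size env).
    rewrite (bigD1 (Ordinal jlt))//= eqnE eqxx scale1r big1 ?addr0// => i ij.
    case: eqP => [ji|]; last by rewrite scale0r.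
    by case/eqP: ij; exact/val_inj.
  rewrite nth_default// big1// => i _; rewrite eqnE; case: eqP => [ji|].
    by move: jge; rewrite -ji leqNgt ltn_ord.
  by rewrite scale0r.
- by rewrite big1// => i _; rewrite scale0r.
- by rewrite -big_split; apply: eq_bigr => i _; rewrite scalerDl.
- by rewrite -sumrN; apply: eq_bigr => i _; rewrite scaleNr.
- by rewrite scaler_sumr; apply: eq_bigr => i _; rewrite scalerA.
Qed.

Lemma leval_eq (env : seq V) t1 t2 :
  lcoef_eq (size env) t1 t2 -> leval env t1 = leval env t2.
Proof.
rewrite !leval_sum => E; apply: eq_bigr => i _; congr (_ *: _).
have := ltn_ord i; move: (nat_of_ord i) => {}i; elim: (size env) E => // k IH /=.
by move=> [Ek E]; rewrite ltnS leq_eqVlt => /predU1P[->//|]; exact: IH.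
Qed.

End LmodReflection.

Ltac lmod_index x env :=
  match env with
  | x :: _ => constr:(O)
  | _ :: ?env' => let i := lmod_index x env' in constr:(S i)
  end.

Ltac lmod_member x env :=
  match env with
  | x :: _ => constr:(true)
  | _ :: ?env' => lmod_member x env'
  | _ => constr:(false)
  end.

Ltac lmod_atoms t env :=
  lazymatch t with
  | (?a + ?b)%R => let env := lmod_atoms a env in lmod_atoms b env
  | (- ?a)%R => lmod_atoms a env
  | (_ *: ?a)%R => lmod_atoms a env
  | 0%R => env
  | _ => lazymatch lmod_member t env with
         | true => env
         | false => constr:(t :: env)
         end
  end.

Ltac lmod_reify t env :=
  lazymatch t with
  | (?a + ?b)%R =>
      let a := lmod_reify a env in let b := lmod_reify b env in
      open_constr:(@LAdd _ a b)
  | (- ?a)%R => let a := lmod_reify a env in open_constr:(@LOpp _ a)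
  | (?c *: ?a)%R => let a := lmod_reify a env in open_constr:(@LScale _ c a)
  | 0%R => open_constr:(@LZero _)
  | _ => let i := lmod_index t env in open_constr:(@LVar _ i)
  end.

(* Decides an equation between linear combinations in a module up to
   identities between scalars, which are left as goals. *)
Ltac lmod_coefs :=
  lazymatch goal with
  | |- @eq ?V ?s ?t =>
      let env := lmod_atoms s (@nil V) in
      let env := lmod_atoms t env in
      let s' := lmod_reify s env in
      let t' := lmod_reify t env in
      refine (@leval_eq _ _ env s' t' _);
      cbn [lcoef_eq lcoef size eqn]; repeat split
  end.

Ltac lmod := lmod_coefs; ring.

(** * The square of the operator in one fibre *)

Section DiracSquareFibre.
Context {C : numFieldType} {V : zmodType} {S : lmodType C} {n : nat}.
(** The data at one point: [x j] encodes eps_j, [phi j v] is the complex coordinate of [v] along it,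
    [a j] and [b v] are Clifford multiplications by conj eps_j and [z10 v]. For the section with
    value [y], [d v] is its derivative along [z10 v] and [H j k] its second derivative D_{eps_j}
    D_{eps_k}. [G j k] and [aG j k] come from the derivatives along eps_j of eps_k and conj eps_k,
    [DT j k l] from that of T(eps_k, eps_l), and [B j k] from the bracket of eps_j and eps_k. *)
Variables (x : 'I_n -> V) (phi : 'I_n -> V -> C) (T : V -> V -> V).
Variables (a : 'I_n -> {linear S -> S}) (b : V -> {linear S -> S}) (d : V -> S).
Variables (G B : 'I_n -> 'I_n -> V) (aG : 'I_n -> 'I_n -> S -> S).
Variables (DT : 'I_n -> 'I_n -> 'I_n -> V) (H : 'I_n -> 'I_n -> S) (y : S).

Hypothesis TBl : forall u v w, T (u - v) w = T u w - T v w.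
Hypothesis TC : forall v w, T v w = - T w v.
Hypothesis bB : forall u v z, b (u - v) z = b u z - b v z.
Hypothesis dB : forall u v, d (u - v) = d u - d v.
Hypothesis aC : forall j k z, a j (a k z) = - a k (a j z).
Hypothesis bC : forall v w z, b v (b w z) = - b w (b v z).
Hypothesis abC : forall j v z, b v (a j z) = - a j (b v z) - (2 * phi j v) *: z.
(** Metricity: as the products of the eps_l and conj eps_k are constant, the connection matrix of
    the conjugate frame is minus the transpose of that of the frame. *)
Hypothesis aGE : forall j k z, aG j k z = - \sum_l phi k (G j l) *: a l z.
(** [V] is a mere additive group without complex scalars, so the complex linearity of the torsion is
    expressed after applying [b]. *)
Hypothesis bTE : forall v w z, \sum_j phi j v *: b (T (x j) w) z = b (T v w) z.
Hypothesis dE : forall v, \sum_j phi j v *: d (x j) = d v.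
Hypothesis torsionE : forall j k, T (x j) (x k) = G j k - G k j - B j k.
Hypothesis bianchi : forall j k l,
  DT j k l + T (x l) (B j k) + (DT k l j + T (x j) (B k l))
  + (DT l j k + T (x k) (B l j)) = 0.

(** Because the [a j] anticommute, [S2] and [S3] retain only the alternating part of [F];
    antisymmetrisation over the frame indices thus becomes [S2_swap], [S3_swap12], [S3_swap23] and
    [S3_cycle]. *)
Let S2 (F : 'I_n -> 'I_n -> S) := \sum_j \sum_k a j (a k (F j k)).
Let S3 (F : 'I_n -> 'I_n -> 'I_n -> S) :=
  \sum_j \sum_k \sum_l a j (a k (a l (F j k l))).

Let bN v z : b (- v) z = - b v z.
Proof. by have := bB 0 v z; have := bB 0 0 z; rewrite subr0 subrr => ->; rewrite !sub0r. Qed.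

Let bD u v z : b (u + v) z = b u z + b v z.
Proof. by rewrite -[v]opprK bB bN !opprK. Qed.

Let eq_S2 F1 F2 : (forall j k, F1 j k = F2 j k) -> S2 F1 = S2 F2.
Proof. by move=> E; apply: eq_bigr => j _; apply: eq_bigr => k _; rewrite E. Qed.

Let eq_S3 F1 F2 : (forall j k l, F1 j k l = F2 j k l) -> S3 F1 = S3 F2.
Proof.
by move=> E; do 3 (apply: eq_bigr => ? _); rewrite E.
Qed.

Let S2_lin c F1 F2 : S2 (fun j k => c *: F1 j k + F2 j k) = c *: S2 F1 + S2 F2.
Proof.
rewrite /S2 scaler_sumr -big_split; apply: eq_bigr => j _ /=.
rewrite scaler_sumr -big_split; apply: eq_bigr => k _ /=.
by rewrite !linearP.
Qed.

Let S3_lin c F1 F2 :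
  S3 (fun j k l => c *: F1 j k l + F2 j k l) = c *: S3 F1 + S3 F2.
Proof.
rewrite /S3 scaler_sumr -big_split; apply: eq_bigr => j _ /=.
rewrite scaler_sumr -big_split; apply: eq_bigr => k _ /=.
rewrite scaler_sumr -big_split; apply: eq_bigr => l _ /=.
by rewrite !linearP.
Qed.

Let S2D F1 F2 : S2 (fun j k => F1 j k + F2 j k) = S2 F1 + S2 F2.
Proof.
rewrite -[S2 F1]scale1r -S2_lin; apply: eq_S2 => j k.
by rewrite scale1r.
Qed.

Let S2B F1 F2 : S2 (fun j k => F1 j k - F2 j k) = S2 F1 - S2 F2.
Proof.
rewrite addrC -[- S2 F2]scaleN1r -S2_lin; apply: eq_S2 => j k.
by rewrite scaleN1r addrC.
Qed.

Let S3D F1 F2 : S3 (fun j k l => F1 j k l + F2 j k l) = S3 F1 + S3 F2.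
Proof.
rewrite -[S3 F1]scale1r -S3_lin; apply: eq_S3 => j k l.
by rewrite scale1r.
Qed.

Let S3B F1 F2 : S3 (fun j k l => F1 j k l - F2 j k l) = S3 F1 - S3 F2.
Proof.
rewrite addrC -[- S3 F2]scaleN1r -S3_lin; apply: eq_S3 => j k l.
by rewrite scaleN1r addrC.
Qed.

Let S2_swap F : S2 (fun j k => F k j) = - S2 F.
Proof.
rewrite /S2 exchange_big -sumrN; apply: eq_bigr => j _ /=.
by rewrite -sumrN; apply: eq_bigr => k _; rewrite aC.
Qed.

Let S3_swap12 F : S3 (fun j k l => F k j l) = - S3 F.
Proof.
rewrite /S3 exchange_big -sumrN; apply: eq_bigr => j _ /=.
rewrite -sumrN; apply: eq_bigr => k _ /=.
by rewrite -sumrN; apply: eq_bigr => l _; rewrite aC.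
Qed.

Let S3_swap23 F : S3 (fun j k l => F j l k) = - S3 F.
Proof.
rewrite /S3 -sumrN; apply: eq_bigr => j _ /=.
rewrite exchange_big -sumrN; apply: eq_bigr => k _ /=.
by rewrite -sumrN; apply: eq_bigr => l _; rewrite [a l (a k _)]aC linearN.
Qed.

Let S3_cycle F : S3 (fun j k l => F k l j) = S3 F.
Proof.
rewrite (S3_swap12 (fun j k l => F j l k)).
by rewrite S3_swap23 opprK.
Qed.

(** Transposing the connection matrix moves it from the Clifford symbols onto the arguments of [F],
    where linearity reassembles it into [G]. *)
Let aG_sum j (F : 'I_n -> S) :
  \sum_k aG j k (F k) = - \sum_l a l (\sum_k phi k (G j l) *: F k).
Proof.
rewrite (eq_bigr _ (fun k _ => aGE j k (F k))) sumrN exchange_big; congr (- _).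
apply: eq_bigr => l _ /=; rewrite linear_sum; apply: eq_bigr => k _.
by rewrite linearZ.
Qed.

Let dirac_symbol_part :
  \sum_j a j (\sum_k aG j k (d (x k))) = - S2 (fun j l => d (G j l)).
Proof.
rewrite -sumrN; apply: eq_bigr => j _; rewrite aG_sum linearN linear_sum.
by congr (- _); apply: eq_bigr => l _; rewrite dE.
Qed.

Let b_aa v j k z : b v (a j (a k z)) =
  a j (a k (b v z)) - (2 * phi j v) *: a k z + (2 * phi k v) *: a j z.
Proof.
rewrite abC abC linearB linearN linearZ /=.
by rewrite opprD !opprK addrAC.
Qed.

Let S2Z c F : S2 (fun j k => c *: F j k) = c *: S2 F.
Proof.
rewrite /S2 scaler_sumr; apply: eq_bigr => j _; rewrite scaler_sumr.
by apply: eq_bigr => k _; rewrite !linearZ.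
Qed.

Let S2_sum (F : 'I_n -> 'I_n -> 'I_n -> S) :
  S2 (fun q r => \sum_k F k q r) = \sum_k S2 (F k).
Proof.
rewrite /S2 [RHS]exchange_big; apply: eq_bigr => q _ /=.
rewrite [RHS]exchange_big; apply: eq_bigr => r _ /=.
by rewrite !linear_sum.
Qed.

Let a_S2 k F : a k (S2 F) = S2 (fun q r => a k (F q r)).
Proof.
rewrite linear_sum; apply: eq_bigr => q _; rewrite linear_sum.
apply: eq_bigr => r _; rewrite aC [a k (a r _)]aC.
by rewrite linearN opprK.
Qed.

(** Products of two [a]'s are even, hence commute with each other. *)
Let S2_S2C F : S2 (fun j k => S2 (F j k)) = S2 (fun q r => S2 (fun j k => F j k q r)).
Proof.
rewrite {2}/S2 S2_sum; apply: eq_bigr => j _; rewrite S2_sum; apply: eq_bigr => k _.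
by rewrite !a_S2.
Qed.

(** The pair a_q a_r commutes with a_k, so the only extra term is the contraction of [b] with [a k].
    It produces the derivative along the torsion, while the first term cancels against the one in
    [torsion_derivative]. *)
Let torsion_commutator (N : 'I_n -> S) :
  S2 (fun q r => b (T (x q) (x r)) (\sum_k a k (N k))) =
  - (\sum_k a k (S2 (fun q r => b (T (x q) (x r)) (N k))))
  - 2 *: S2 (fun q r => \sum_k phi k (T (x q) (x r)) *: N k).
Proof.
have E q r : b (T (x q) (x r)) (\sum_k a k (N k)) =
    - 1 *: (\sum_k a k (b (T (x q) (x r)) (N k)))
    + - 2 *: \sum_k phi k (T (x q) (x r)) *: N k.
  rewrite linear_sum !scaler_sumr -big_split; apply: eq_bigr => k _ /=.
  by rewrite abC; lmod.
rewrite (eq_S2 E) S2_lin S2Z S2_sum scaleN1r scaleNr; congr (- _ - _).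
by apply: eq_bigr => k _; rewrite a_S2.
Qed.

(** Moving the first [b] across the second pair of [a]'s leaves an uncontracted term, which
    vanishes, and two contractions, which T being alternating makes equal. *)
Let torsion_square z :
  S2 (fun q r => b (T (x q) (x r)) (S2 (fun u v => b (T (x u) (x v)) z))) =
  - 4 *: S3 (fun q r v => b (T (T (x q) (x r)) (x v)) z).
Proof.
pose Z q r u v := b (T (x q) (x r)) (b (T (x u) (x v)) z).
have E q r : b (T (x q) (x r)) (S2 (fun u v => b (T (x u) (x v)) z)) =
    S2 (Z q r) + - 4 *: \sum_v a v (b (T (T (x q) (x r)) (x v)) z).
  set w := T (x q) (x r).
  have E1 : \sum_u \sum_v phi u w *: a v (b (T (x u) (x v)) z) =
      \sum_v a v (b (T w (x v)) z).
    rewrite exchange_big; apply: eq_bigr => v _; rewrite -bTE linear_sum.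
    by apply: eq_bigr => u _; rewrite linearZ.
  have E2 : \sum_u \sum_v phi v w *: a u (b (T (x u) (x v)) z) =
      - \sum_v a v (b (T w (x v)) z).
    rewrite -E1 exchange_big -sumrN; apply: eq_bigr => u _.
    rewrite -sumrN; apply: eq_bigr => v _.
    by rewrite TC bN linearN scalerN.
  (* The two contractions in [b_aa] have coefficients -2 and 2, and their sums [E1] and [E2] are
     opposite. *)
  have -> : - 4 *: \sum_v a v (b (T w (x v)) z) =
      - 2 *: (\sum_u \sum_v phi u w *: a v (b (T (x u) (x v)) z)) +
      2 *: \sum_u \sum_v phi v w *: a u (b (T (x u) (x v)) z).
    by rewrite E1 E2; lmod.
  rewrite linear_sum !scaler_sumr -!big_split; apply: eq_bigr => u _ /=.
  rewrite linear_sum !scaler_sumr -!big_split; apply: eq_bigr => v _ /=.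
  by rewrite b_aa /Z -/w; lmod.
rewrite (eq_S2 E) S2D S2Z.
(* Exchanging the two pairs of indices leaves the four [a]'s unchanged but swaps the two [b]'s, so
   the sum is its own opposite. *)
have -> : S2 (fun q r => S2 (Z q r)) = 0.
  have : S2 (fun q r => S2 (Z q r)) = - S2 (fun q r => S2 (Z q r)).
    rewrite [in LHS]S2_S2C -[RHS]scaleN1r -S2Z; apply: eq_S2 => q r.
    by rewrite -S2Z; apply: eq_S2 => u v; rewrite /Z bC scaleN1r.
  move/eqP; rewrite -subr_eq0 opprK -mulr2n -scaler_nat scaler_eq0 pnatr_eq0 /=.
  by move/eqP ->.
rewrite add0r; congr (_ *: _); apply: eq_bigr => q _; apply: eq_bigr => r _.
by rewrite !linear_sum.
Qed.

Let Theta z := S2 (fun q r => b (T (x q) (x r)) z).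
Let S3T := S3 (fun j k l => b (T (T (x j) (x k)) (x l)) y).
Let S3G := S3 (fun j k l => b (T (G j k) (x l)) y).
Let S3D' := S3 (fun j k l => b (DT j k l) y).

(** This is the alternated Bianchi identity for the covariant derivative of T: differentiating
    T(eps_k, eps_l) as a field also differentiates its two arguments, and removing these
    contributions costs [S3G] twice. *)
Let bianchi_sum : S3D' - 2 *: S3G + S3T = 0.
Proof.
have EG : 2 *: S3G = S3 (fun j k l => b (T (B j k) (x l)) y) + S3T.
  have -> : 2 *: S3G = S3G - S3 (fun j k l => b (T (G k j) (x l)) y).
    by rewrite (S3_swap12 (fun j k l => b (T (G j k) (x l)) y)) -/S3G; lmod.
  rewrite -S3B -S3D; apply: eq_S3 => j k l.
  by rewrite torsionE !TBl !bB; lmod.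
have -> : S3D' - 2 *: S3G + S3T =
    S3 (fun j k l => b (DT j k l + T (x l) (B j k)) y).
  rewrite EG opprD addrA subrK -S3B; apply: eq_S3 => j k l.
  by rewrite -bB [T (x l) _]TC.
set F := fun j k l => b (DT j k l + T (x l) (B j k)) y.
(* [S3] is invariant under cyclic permutations, so three times it is [S3] of the cyclic sum, to
   which [bianchi] applies. *)
have : 3 *: S3 F = 0.
  have -> : 3 *: S3 F = S3 F + S3 (fun j k l => F k l j) + S3 (fun j k l => F l j k).
    by rewrite (S3_cycle (fun j k l => F k l j)) (S3_cycle F); lmod.
  rewrite -!S3D /S3 big1// => j _; rewrite big1// => k _; rewrite big1// => l _.
  by rewrite -!bD bianchi -[0](subrr 0) bB subrr !linear0.
by move/eqP; rewrite scaler_eq0 pnatr_eq0 /= => /eqP.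
Qed.

(** The four summands are the product rule for a_q a_r b_T y. Each derivative of an [a] gives
    [- S3G], once the transposed matrix has been absorbed into an argument of T. *)
Let torsion_derivative : \sum_j a j (\sum_q \sum_r
    (aG j q (a r (b (T (x q) (x r)) y)) + a q (aG j r (b (T (x q) (x r)) y))
     + a q (a r (b (DT j q r) y)) + a q (a r (b (T (x q) (x r)) (d (x j)))))) =
  S3D' - 2 *: S3G + \sum_j a j (Theta (d (x j))).
Proof.
have E1 : \sum_j a j (\sum_q \sum_r aG j q (a r (b (T (x q) (x r)) y))) = - S3G.
  rewrite -sumrN; apply: eq_bigr => j _; rewrite exchange_big.
  under [X in - X]eq_bigr => k _ do rewrite -linear_sum.
  rewrite -linear_sum -linearN; congr (a j _).
  rewrite /= [in RHS]exchange_big -sumrN; apply: eq_bigr => r _ /=.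
  rewrite aG_sum; congr (- _); apply: eq_bigr => l _.
  congr (a l _); rewrite -bTE linear_sum.
  by apply: eq_bigr => q _; rewrite linearZ.
have E2 : \sum_j a j (\sum_q \sum_r a q (aG j r (b (T (x q) (x r)) y))) = - S3G.
  rewrite -(S3_swap23 (fun j k l => b (T (G j k) (x l)) y)).
  apply: eq_bigr => j _; under [RHS]eq_bigr => k _ do rewrite -linear_sum.
  rewrite -[RHS]linear_sum; congr (a j _); apply: eq_bigr => q _.
  rewrite -[LHS]linear_sum -[RHS]linear_sum; congr (a q _).
  rewrite aG_sum -sumrN; apply: eq_bigr => l _; rewrite -linearN.
  congr (a l _); rewrite -bTE -sumrN; apply: eq_bigr => r _.
  by rewrite TC bN scalerN opprK.
have -> : S3D' - 2 *: S3G = - S3G + - S3G + S3D' by lmod.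
rewrite -[in X in X + _ + _]E1 -E2 -!big_split; apply: eq_bigr => j _ /=.
under [X in _ + _ + X + _]eq_bigr => q _ do rewrite -linear_sum.
rewrite -[X in _ + _ + X + _]linear_sum -!linearD -!big_split; congr (a j _).
by apply: eq_bigr => q _ /=; rewrite -!big_split.
Qed.

(** The left-hand side is the operator applied twice with all product rules carried out, so what
    remains is pure algebra in one fibre. *)
Lemma dirac_square_fibre :
  \sum_j a j (\sum_k (aG j k (d (x k)) + a k (H j k))
    - 4^-1 *: \sum_q \sum_r
      (aG j q (a r (b (T (x q) (x r)) y)) + a q (aG j r (b (T (x q) (x r)) y))
       + a q (a r (b (DT j q r) y)) + a q (a r (b (T (x q) (x r)) (d (x j))))))
  - 4^-1 *: \sum_q \sum_r a q (a r (b (T (x q) (x r))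
      (\sum_k a k (d (x k))
       - 4^-1 *: \sum_u \sum_v a u (a v (b (T (x u) (x v)) y)))))
  = 2^-1 *: \sum_j \sum_k a j (a k (H j k - H k j - d (B j k))).
Proof.
(* Replaces the bracket by [G j k - G k j] minus the torsion; alternation then doubles the terms in
   [H] and [G]. *)
have hd : S2 (fun j k => H j k - H k j - d (B j k)) =
    2 *: S2 H - 2 *: S2 (fun j k => d (G j k)) + S2 (fun q r => d (T (x q) (x r))).
  have -> : 2 *: S2 H = S2 H - S2 (fun j k => H k j) by rewrite S2_swap; lmod.
  have -> : 2 *: S2 (fun j k => d (G j k)) =
      S2 (fun j k => d (G j k)) - S2 (fun j k => d (G k j)).
    by rewrite (S2_swap (fun j k => d (G j k))); lmod.
  rewrite -!S2B -S2D; apply: eq_S2 => j k; rewrite torsionE !dB; lmod.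
set Q := \sum_j _; set P := \sum_q _.
have {Q}-> : Q = - S2 (fun j k => d (G j k)) + S2 H
    - 4^-1 *: (S3D' - 2 *: S3G + \sum_j a j (Theta (d (x j)))).
  rewrite -torsion_derivative -dirac_symbol_part /Q scaler_sumr -sumrN.
  rewrite -!big_split; apply: eq_bigr => j _ /=.
  rewrite linearB linearZ big_split linearD /=.
  by congr (_ + _ - _); exact: linear_sum.
have {P}-> : P = - (\sum_k a k (Theta (d (x k))))
    - 2 *: S2 (fun q r => d (T (x q) (x r))) + S3T.
  rewrite -[P]/(S2 (fun q r => b (T (x q) (x r))
    (\sum_k a k (d (x k)) - 4^-1 *: S2 (fun u v => b (T (x u) (x v)) y)))).
  rewrite (eq_S2 (F2 := fun q r => b (T (x q) (x r)) (\sum_k a k (d (x k)))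
    + - 4^-1 *: b (T (x q) (x r)) (S2 (fun u v => b (T (x u) (x v)) y)))).
    rewrite S2D S2Z torsion_commutator torsion_square -/S3T; congr (_ - _ + _).
      by congr (_ *: _); apply: eq_S2 => q r; rewrite dE.
    by lmod_coefs; field.
  by move=> q r; rewrite linearB linearZ scaleNr.
transitivity (2^-1 *: S2 (fun j k => H j k - H k j - d (B j k))) => //; rewrite hd.
(* The zero-order terms come out as -1/4 times the sum that vanishes by [bianchi_sum]. *)
move/eqP: bianchi_sum; rewrite addr_eq0 => /eqP ->.
by lmod_coefs; field.
Qed.

End DiracSquareFibre.

(** * The Chern connection *)

Section HermitianStructures.
Context {R : realType} {n : nat} {M : hermitian_manifold R n}.

(* Instantiated at both [hJ] and [- hJ]. *)
Record hermitian_structure (D : tconnection M)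
    (J : forall p : M, tangent p -> tangent p) : Prop := HermitianStructure {
  hs_conn : is_tconnection D;
  hs_lin : forall p (a : R) (v w : tangent p), J p (a *: v + w) = a *: J p v + J p w;
  hs_sq : forall p (v : tangent p), J p (J p v) = - v;
  hs_smooth : forall (U : set M) (X : vfield M), open U ->
    smooth_vf U X -> smooth_vf U (fun p => J p (X p));
  hs_integrable : forall (U : set M) (X Y : vfield M) p,
    open U -> U p -> smooth_vf U X -> smooth_vf U Y ->
    bracket (fun q => J q (X q)) (fun q => J q (Y q)) p
      - J p (bracket (fun q => J q (X q)) Y p)
      - J p (bracket X (fun q => J q (Y q)) p) - bracket X Y p = 0;
  hs_isometry : forall p (v w : tangent p), hmetric (J p v) (J p w) = hmetric v w;
  hs_metric : forall (U : set M) (X Y : vfield M) p, open U -> U p ->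
    smooth_vf U X -> smooth_vf U Y -> forall v : tangent p,
    v (fun q => hmetric (X q) (Y q)) =
      hmetric (D p v X) (Y p) + hmetric (X p) (D p v Y);
  hs_parallel : forall (U : set M) (X : vfield M) p, open U -> U p ->
    smooth_vf U X -> forall v : tangent p,
    D p v (fun q => J q (X q)) = J p (D p v X);
  hs_torsion : forall (U : set M) (X Y : vfield M) p, open U -> U p ->
    smooth_vf U X -> smooth_vf U Y ->
    torsion D (fun q => J q (X q)) Y p = torsion D X (fun q => J q (Y q)) p }.

Section Connection.
Variables (D : tconnection M) (U : set M).
Arguments D : clear implicits.
Hypotheses (hD : is_tconnection D) (oU : open U).
Implicit Types (X Y Z : vfield M) (p : M).

Lemma conn_dirD p (v w : tangent p) X : U p -> smooth_vf U X ->
  D p (v + w) X = D p v X + D p w X.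
Proof. by move=> Up sX; have := tconn_lin hD oU Up sX 1 v w; rewrite !scale1r. Qed.

Lemma conn_dir0 p X : U p -> smooth_vf U X -> D p 0 X = 0.
Proof.
move=> Up sX; have /eqP := conn_dirD 0 0 Up sX.
by rewrite addr0 -subr_eq subrr eq_sym => /eqP.
Qed.

Lemma conn_dirZ p (a : R) (v : tangent p) X : U p -> smooth_vf U X ->
  D p (a *: v) X = a *: D p v X.
Proof.
by move=> Up sX; have := tconn_lin hD oU Up sX a v 0; rewrite conn_dir0// !addr0.
Qed.

Lemma conn_dirN p (v : tangent p) X : U p -> smooth_vf U X ->
  D p (- v) X = - D p v X.
Proof. by move=> Up sX; rewrite -scaleN1r conn_dirZ// scaleN1r. Qed.

Lemma conn_vfZ p (v : tangent p) (a : R) X : U p -> smooth_vf U X ->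
  D p v (fun q => a *: X q) = a *: D p v X.
Proof.
move=> Up sX; rewrite (tconn_leibniz hD oU Up (smooth_on_cst U a) sX).
by rewrite tangent_cst scale0r add0r.
Qed.

Lemma conn_vfD p (v : tangent p) X Y : U p -> smooth_vf U X -> smooth_vf U Y ->
  D p v (fun q => X q + Y q) = D p v X + D p v Y.
Proof. by move=> Up sX sY; exact: (tconn_add hD oU). Qed.

Lemma conn_vfN p (v : tangent p) X : U p -> smooth_vf U X ->
  D p v (fun q => - X q) = - D p v X.
Proof.
move=> Up sX; rewrite -[RHS]scaleN1r -conn_vfZ//.
by congr (D p v _); apply: functional_extensionality_dep => q; rewrite scaleN1r.
Qed.

Lemma conn_vfB p (v : tangent p) X Y : U p -> smooth_vf U X -> smooth_vf U Y ->
  D p v (fun q => X q - Y q) = D p v X - D p v Y.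
Proof. by move=> Up sX sY; rewrite conn_vfD ?conn_vfN//; exact: smooth_vfN. Qed.

Lemma smooth_conn X Y : smooth_vf U X -> smooth_vf U Y ->
  smooth_vf U (fun q => D q (X q) Y).
Proof. exact: (tconn_smooth hD). Qed.

Lemma eq_conn p (v : tangent p) X Y : U p -> smooth_vf U X ->
  (forall q, U q -> X q = Y q) -> D p v X = D p v Y.
Proof.
by move=> Up sX XY; apply: (tconn_local hD oU) => //; exact: eq_smooth_vf sX.
Qed.

Lemma smooth_torsion X Y : smooth_vf U X -> smooth_vf U Y ->
  smooth_vf U (torsion D X Y).
Proof.
move=> sX sY; apply: smooth_vfB; last exact: smooth_bracket.
by apply: smooth_vfB; exact: smooth_conn.
Qed.

Lemma eq_torsion X X' Y Y' p : U p -> smooth_vf U X -> smooth_vf U Y ->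
  (forall q, U q -> X q = X' q) -> (forall q, U q -> Y q = Y' q) ->
  torsion D X Y p = torsion D X' Y' p.
Proof.
move=> Up sX sY XX' YY'; rewrite /torsion (eq_bracket oU Up sX sY XX' YY').
by rewrite -XX'// -YY'// (eq_conn _ Up sX XX') (eq_conn _ Up sY YY').
Qed.

Lemma torsionC X Y p : U p -> smooth_vf U X -> smooth_vf U Y ->
  torsion D X Y p = - torsion D Y X p.
Proof. by move=> Up sX sY; rewrite /torsion (bracketC oU)//; lmod. Qed.

Lemma torsionDl X Y Z p : U p -> smooth_vf U X -> smooth_vf U Y ->
  smooth_vf U Z ->
  torsion D (fun q => X q + Y q) Z p = torsion D X Z p + torsion D Y Z p.
Proof.
move=> Up sX sY sZ; rewrite /torsion conn_dirD// conn_vfD//.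
rewrite (bracketC oU Up (smooth_vfD sX sY) sZ) (bracketDr oU)//.
by rewrite (bracketC oU Up sX sZ) (bracketC oU Up sY sZ); lmod.
Qed.

Lemma torsionMl f X Y p : U p -> smooth_on U f -> smooth_vf U X ->
  smooth_vf U Y -> torsion D (fun q => f q *: X q) Y p = f p *: torsion D X Y p.
Proof.
move=> Up sf sX sY; rewrite /torsion conn_dirZ// (tconn_leibniz hD oU)//.
rewrite (bracketC oU Up (smooth_vfM sf sX) sY) (bracketMr oU)//.
by rewrite (bracketC oU Up sX sY); lmod.
Qed.

Lemma torsionNl X Y p : U p -> smooth_vf U X -> smooth_vf U Y ->
  torsion D (fun q => - X q) Y p = - torsion D X Y p.
Proof.
move=> Up sX sY; rewrite -[RHS]scaleN1r.
rewrite -(torsionMl Up (smooth_on_cst U (-1)) sX sY).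
by congr (torsion D _ Y p); apply: functional_extensionality_dep => q; rewrite scaleN1r.
Qed.

Lemma torsion_suml (I : Type) (r : seq I) (X : I -> vfield M) Y p :
  U p -> (forall i, smooth_vf U (X i)) -> smooth_vf U Y ->
  torsion D (fun q => \sum_(i <- r) X i q) Y p
  = \sum_(i <- r) torsion D (X i) Y p.
Proof.
move=> Up sX sY; elim: r => [|i r IH].
  rewrite big_nil -[RHS](scale0r (torsion D (fun=> 0) Y p)).
  rewrite -(torsionMl Up (smooth_on_cst U 0) (@smooth_vf0 _ _ _ U) sY).
  by congr (torsion D _ Y p); apply: functional_extensionality_dep => q;
    rewrite big_nil scale0r.
rewrite big_cons -IH -torsionDl//; last exact: smooth_vf_sum.
by congr (torsion D _ Y p); apply: functional_extensionality_dep => q; rewrite big_cons.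
Qed.

Definition tangent_curvature X Y Z : vfield M := fun p =>
  D p (X p) (fun q => D q (Y q) Z) - D p (Y p) (fun q => D q (X q) Z)
  - D p (bracket X Y p) Z.

(** Expanding the torsions, the derivatives of brackets cancel and the double brackets vanish by
    Jacobi. Keeping T(X, [Y, Z]) rather than the covariant derivative of T avoids a product rule for
    T. *)
Lemma first_bianchi X Y Z p : U p -> smooth_vf U X -> smooth_vf U Y ->
  smooth_vf U Z ->
  tangent_curvature X Y Z p + tangent_curvature Y Z X p + tangent_curvature Z X Y p
  = D p (X p) (torsion D Y Z) + torsion D X (bracket Y Z) p
    + (D p (Y p) (torsion D Z X) + torsion D Y (bracket Z X) p)
    + (D p (Z p) (torsion D X Y) + torsion D Z (bracket X Y) p).
Proof.
move=> Up sX sY sZ.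
have sB (A B : vfield M) : smooth_vf U A -> smooth_vf U B ->
    smooth_vf U (bracket A B) by exact: smooth_bracket.
have E (A B C : vfield M) : smooth_vf U A -> smooth_vf U B -> smooth_vf U C ->
    D p (A p) (torsion D B C) = D p (A p) (fun q => D q (B q) C)
      - D p (A p) (fun q => D q (C q) B) - D p (A p) (bracket B C).
  move=> sA sB' sC; have sBC := smooth_conn sB' sC; have sCB := smooth_conn sC sB'.
  by rewrite -conn_vfB// -conn_vfB//; [exact: smooth_vfB|exact: sB].
rewrite !E// /tangent_curvature /torsion.
have := jacobi oU Up sX sY sZ.
rewrite (bracketC oU Up (sB _ _ sX sY) sZ).
have -> : bracket Y (bracket X Z) p = - bracket Y (bracket Z X) p.
  rewrite -(bracketNr oU)//; last exact: sB.
  apply: (eq_bracket oU) => //; first exact: sB.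
  by move=> q Uq; exact: (bracketC oU).
rewrite !opprK => /eqP; rewrite -subr_eq0 opprK => /eqP J0.
rewrite -[LHS]subr0 -J0; lmod.
Qed.

End Connection.
End HermitianStructures.

(** * Torsion and curvature against [J]; complex scalars and unitary frames *)

Section HermitianGeometry.
Context {R : realType} {n : nat} {M : hermitian_manifold R n}.
Implicit Types (p : M) (X Y Z : vfield M).

Lemma hmetricDl p (u v w : tangent p) : hmetric (u + v) w = hmetric u w + hmetric v w.
Proof. by have := hmetric_lin 1 u v w; rewrite scale1r mul1r. Qed.

Lemma hmetric0l p (w : tangent p) : hmetric 0 w = 0.
Proof.
have /eqP := hmetricDl 0 0 w.
by rewrite addr0 -subr_eq subrr eq_sym => /eqP.
Qed.

Lemma hmetricZl p (a : R) (v w : tangent p) : hmetric (a *: v) w = a * hmetric v w.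
Proof. by have := hmetric_lin a v 0 w; rewrite hmetric0l !addr0. Qed.

Lemma hmetricNl p (v w : tangent p) : hmetric (- v) w = - hmetric v w.
Proof. by rewrite -scaleN1r hmetricZl mulN1r. Qed.

Lemma hmetricDr p (u v w : tangent p) : hmetric w (u + v) = hmetric w u + hmetric w v.
Proof. by rewrite hmetric_sym hmetricDl !(hmetric_sym w). Qed.

Lemma hmetricZr p (a : R) (v w : tangent p) : hmetric w (a *: v) = a * hmetric w v.
Proof. by rewrite hmetric_sym hmetricZl (hmetric_sym w). Qed.

Lemma hmetricNr p (v w : tangent p) : hmetric w (- v) = - hmetric w v.
Proof. by rewrite hmetric_sym hmetricNl (hmetric_sym w). Qed.

Lemma hmetric_eq0 p (v : tangent p) : hmetric v v = 0 -> v = 0.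
Proof.
move=> v0; apply/eqP/negPn/negP => /hmetric_pos.
by rewrite v0 ltxx.
Qed.

Lemma hmetric_sumr p (I : Type) (r : seq I) (v : I -> tangent p) (w : tangent p) :
  hmetric w (\sum_(i <- r) v i) = \sum_(i <- r) hmetric w (v i).
Proof.
elim: r => [|i r IH]; first by rewrite !big_nil hmetric_sym hmetric0l.
by rewrite !big_cons hmetricDr IH.
Qed.

Definition hmetricE :=
  (hmetricDl, hmetricZl, hmetricNl, hmetricDr, hmetricZr, hmetricNr).

Section Structure.
Variables (D : tconnection M) (J : forall p : M, tangent p -> tangent p).
Variable U : set M.
Arguments D : clear implicits.
Arguments J : clear implicits.
Hypotheses (hJ : hermitian_structure D J) (oU : open U).

Local Notation hD := (hs_conn hJ).
Local Notation "'j' X" := (fun q => J q (X q)) (at level 10, X at level 9).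

Lemma JD p (v w : tangent p) : J p (v + w) = J p v + J p w.
Proof. by have := hs_lin hJ 1 v w; rewrite !scale1r. Qed.

Lemma J0 p : J p 0 = 0.
Proof.
have /eqP := JD (0 : tangent p) 0.
by rewrite addr0 -subr_eq subrr eq_sym => /eqP.
Qed.

Lemma JZ p (a : R) (v : tangent p) : J p (a *: v) = a *: J p v.
Proof. by have := hs_lin hJ a v 0; rewrite J0 !addr0. Qed.

Lemma JN p (v : tangent p) : J p (- v) = - J p v.
Proof. by rewrite -scaleN1r JZ scaleN1r. Qed.

Lemma JJ p (v : tangent p) : J p (J p v) = - v.
Proof. exact: hs_sq hJ _ _. Qed.

Definition JE := (JD, JZ, JN, JJ).

Lemma hmetric_Jl p (v w : tangent p) : hmetric (J p v) w = - hmetric v (J p w).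
Proof. by rewrite -[LHS](hs_isometry hJ) JJ hmetricNl. Qed.

Lemma smooth_J X : smooth_vf U X -> smooth_vf U (j X).
Proof. exact: (hs_smooth hJ). Qed.

Lemma conn_J p (v : tangent p) X : U p -> smooth_vf U X ->
  D p v (j X) = J p (D p v X).
Proof. by move=> Up sX; exact: (hs_parallel hJ oU). Qed.

Lemma bracket_JJ X Y p : U p -> smooth_vf U X -> smooth_vf U Y ->
  bracket (j X) (j Y) p =
  bracket X Y p + J p (bracket (j X) Y p) + J p (bracket X (j Y) p).
Proof.
move=> Up sX sY; apply/eqP; rewrite -subr_eq0; apply/eqP.
by rewrite -[RHS](hs_integrable hJ oU Up sX sY); lmod.
Qed.

(** As [J] is parallel, the Nijenhuis tensor becomes the combination T(X, Y) + J T(JX, Y) + J T(X,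
    JY) - T(JX, JY). The Chern condition makes its halves equal. With [torsion_Jr] this says that T
    is complex bilinear for [J]. *)
Lemma torsion_Jl X Y p : U p -> smooth_vf U X -> smooth_vf U Y ->
  torsion D (j X) Y p = J p (torsion D X Y p).
Proof.
move=> Up sX sY; have sJX := smooth_J sX; have sJY := smooth_J sY.
have Tr := hs_torsion hJ oU Up sX sY.
have : 2 *: (torsion D X Y p + J p (torsion D (j X) Y p)) = 0.
  have -> : 2 *: (torsion D X Y p + J p (torsion D (j X) Y p)) =
      torsion D X Y p + J p (torsion D (j X) Y p) + J p (torsion D X (j Y) p)
      - torsion D (j X) (j Y) p.
    rewrite (hs_torsion hJ oU Up sX sJY) -Tr.
    have -> : torsion D X (fun q => J q (J q (Y q))) p = - torsion D X Y p.
      rewrite (torsionC D oU Up sX (smooth_J sJY)) (torsionC D oU Up sX sY) opprK.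
      rewrite -(torsionNl hD oU)//; last exact: smooth_J.
      apply: (eq_torsion hD oU) => //; last by move=> q _; rewrite JJ opprK.
      by apply: smooth_vfN; exact: smooth_J.
    by lmod.
  rewrite /torsion !(conn_J _ Up)// !JE bracket_JJ//; lmod.
move/eqP; rewrite scaler_eq0 pnatr_eq0 /= addr_eq0 => /eqP ->.
by rewrite JN JJ opprK.
Qed.

Lemma torsion_Jr X Y p : U p -> smooth_vf U X -> smooth_vf U Y ->
  torsion D X (j Y) p = J p (torsion D X Y p).
Proof. by move=> Up sX sY; rewrite -(hs_torsion hJ oU)// torsion_Jl. Qed.

(** Real encoding of D_{X + iJX} (Z - iJZ): the (0,1)-part of [D] on (1,0)-fields. *)
Let dbar X Z : vfield M := fun p => D p (X p) Z + J p (D p (J p (X p)) Z).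

(** In T(JX, Z) = J T(X, Z) the derivatives along [Z] cancel because [J] is parallel; what is left
    is the Cauchy-Riemann operator of the holomorphic tangent bundle. *)
Let dbarE X Z p : U p -> smooth_vf U X -> smooth_vf U Z ->
  dbar X Z p = bracket X Z p + J p (bracket (j X) Z p).
Proof.
move=> Up sX sZ; have := torsion_Jl Up sX sZ.
rewrite /torsion conn_J// => /(congr1 (J p))/eqP.
rewrite -subr_eq0 !JE => /eqP E; apply/eqP; rewrite -subr_eq0; apply/eqP.
by rewrite -[RHS]E /dbar; lmod.
Qed.

Let smooth_dbar X Z : smooth_vf U X -> smooth_vf U Z -> smooth_vf U (dbar X Z).
Proof.
move=> sX sZ; apply: smooth_vfD; first exact: (smooth_conn hD oU).
by apply: smooth_J; apply: (smooth_conn hD oU) => //; exact: smooth_J.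
Qed.

Let dbar_bracket X Y Z p : U p -> smooth_vf U X -> smooth_vf U Y -> smooth_vf U Z ->
  dbar X (dbar Y Z) p = dbar X (bracket Y Z) p + J p (dbar X (bracket (j Y) Z) p).
Proof.
move=> Up sX sY sZ; have sJY := smooth_J sY.
have sB := smooth_bracket oU sY sZ; have sB' := smooth_bracket oU sJY sZ.
have E v : D p v (dbar Y Z) =
    D p v (bracket Y Z) + J p (D p v (bracket (j Y) Z)).
  rewrite -conn_J// -(conn_vfD hD oU)//; last exact: smooth_J.
  apply: (eq_conn hD oU) => //; first exact: smooth_dbar.
  by move=> q Uq; exact: dbarE.
by rewrite /dbar -/(dbar Y Z) !E !JE; lmod.
Qed.

(** The commutator of [X] and [Y] minus their bracket annihilates the function g(Z, W); the products
    of first derivatives are symmetric in [X] and [Y]. *)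
Lemma tangent_curvature_skew X Y Z W p : U p -> smooth_vf U X -> smooth_vf U Y ->
  smooth_vf U Z -> smooth_vf U W ->
  hmetric (tangent_curvature D X Y Z p) (W p) =
  - hmetric (Z p) (tangent_curvature D X Y W p).
Proof.
move=> Up sX sY sZ sW.
have sg (A B : vfield M) : smooth_vf U A -> smooth_vf U B ->
    smooth_near p (fun q => hmetric (A q) (B q)).
  by move=> sA sB; apply: (smooth_on_near oU Up); exact: hmetric_smooth.
have sD (A B : vfield M) : smooth_vf U A -> smooth_vf U B ->
    smooth_vf U (fun q => D q (A q) B) by exact: (smooth_conn hD oU).
have E (A B : vfield M) : smooth_vf U A -> smooth_vf U B ->
    A p (fun q => B q (fun r => hmetric (Z r) (W r))) =
    hmetric (D p (A p) (fun q => D q (B q) Z)) (W p) +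
    hmetric (D p (B p) Z) (D p (A p) W) +
    (hmetric (D p (A p) Z) (D p (B p) W) +
     hmetric (Z p) (D p (A p) (fun q => D q (B q) W))).
  move=> sA sB.
  rewrite -!(hs_metric hJ oU Up)//; try exact: sD.
  rewrite -tangent_add; [|apply: sg => //; exact: sD..].
  apply: (eq_tangent _ oU Up).
    by move=> q Uq; rewrite (hs_metric hJ oU Uq).
  by apply: (smooth_vf_near oU Up) => //; exact: sg.
have := bracketE oU Up sX sY (sg _ _ sZ sW).
rewrite (hs_metric hJ oU Up)// !E// /tangent_curvature !hmetricE => H.
apply/eqP; rewrite -subr_eq0; apply/eqP; move/eqP: H; rewrite -subr_eq0 => /eqP H.
by rewrite -[RHS]oppr0 -H; ring.
Qed.

Lemma tangent_curvature_Jr X Y Z p : U p -> smooth_vf U X -> smooth_vf U Y ->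
  smooth_vf U Z ->
  tangent_curvature D X Y (j Z) p = J p (tangent_curvature D X Y Z p).
Proof.
move=> Up sX sY sZ; rewrite /tangent_curvature conn_J// !JE.
have E (A B : vfield M) : smooth_vf U A -> smooth_vf U B ->
    D p (A p) (fun q => D q (B q) (j Z)) = J p (D p (A p) (fun q => D q (B q) Z)).
  move=> sA sB; rewrite -conn_J//; last exact: (smooth_conn hD oU).
  apply: (eq_conn hD oU) => //; last by move=> q Uq; rewrite conn_J.
  by apply: (smooth_conn hD oU) => //; exact: smooth_J.
by rewrite !E.
Qed.

(* The (0,1)-part of [D] is given by brackets alone, so it is flat by the Jacobi
   identity; the curvature being skew, its (2,0)-part vanishes as well. *)
Lemma tangent_curvature_J X Y Z p : U p -> smooth_vf U X -> smooth_vf U Y ->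
  smooth_vf U Z ->
  tangent_curvature D (j X) Y Z p = - tangent_curvature D X (j Y) Z p.
Proof.
move=> Up sX sY; have sJX := smooth_J sX; have sJY := smooth_J sY.
pose Q Z := fun p => tangent_curvature D (j X) Y Z p + tangent_curvature D X (j Y) Z p.
pose A Z := fun p => tangent_curvature D X Y Z p - tangent_curvature D (j X) (j Y) Z p.
(* [A W + J (Q W)] encodes the curvature on (X + iJX, Y + iJY). The bracket of these two fields is V
   + iJV for the [V] below, by integrability. *)
have flat W : smooth_vf U W -> A W p + J p (Q W p) = 0.
  move=> sW; have sXY := smooth_bracket oU sX sY.
  have sJXJY := smooth_bracket oU sJX sJY.
  pose V q := bracket X Y q - bracket (j X) (j Y) q.
  have sV : smooth_vf U V by exact: smooth_vfB.
  have sJV : forall q, U q -> J q (V q) = bracket (j X) Y q + bracket X (j Y) q.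
    by move=> q Uq; rewrite /V bracket_JJ// !JE; lmod.
  have eJV : bracket (j V) W p = bracket (bracket (j X) Y) W p + bracket (bracket X (j Y)) W p.
    have s1 := smooth_bracket oU sJX sY; have s2 := smooth_bracket oU sX sJY.
    rewrite (bracketC oU Up s1 sW) (bracketC oU Up s2 sW) -opprD -(bracketDr oU)//.
    rewrite -(bracketC oU) //; last exact: smooth_vfD.
    by apply: (eq_bracket oU) => //; exact: smooth_J.
  have eD : dbar X (dbar Y W) p - dbar Y (dbar X W) p - dbar V W p = A W p + J p (Q W p).
    have sDD (B : vfield M) : smooth_vf U B -> smooth_vf U (fun q => D q (B q) W).
      by move=> sB; exact: (smooth_conn hD oU).
    have E v (B : vfield M) : smooth_vf U B -> D p v (dbar B W) =
        D p v (fun q => D q (B q) W) + J p (D p v (fun q => D q (J q (B q)) W)).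
      move=> sB; have sDJ : smooth_vf U (fun q => D q (J q (B q)) W).
        by apply: (smooth_conn hD oU) => //; exact: smooth_J.
      by rewrite -conn_J// -(conn_vfD hD oU)//; [exact: sDD|exact: smooth_J].
    rewrite /dbar -/(dbar X W) -/(dbar Y W) !E// sJV// /A /Q /tangent_curvature.
    rewrite !(conn_dirD hD oU)// !(conn_dirN hD oU)// !JE; lmod.
  (* With only brackets left, the three terms cancel by the Jacobi identity. *)
  rewrite -eD !dbar_bracket// !dbarE//; try exact: smooth_bracket.
  rewrite eJV /V (bracketBl oU)// -!(jacobi oU)// !JE; lmod.
move=> sZ; pose W q := J q (Q Z q).
have sQ : smooth_vf U (Q Z).
  have sR (B C : vfield M) : smooth_vf U B -> smooth_vf U C ->
      smooth_vf U (tangent_curvature D B C Z).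
    move=> sB sC; apply: smooth_vfB; first apply: smooth_vfB;
      apply: (smooth_conn hD oU) => //; try exact: (smooth_conn hD oU).
    exact: smooth_bracket.
  by apply: smooth_vfD; exact: sR.
have sW : smooth_vf U W by exact: smooth_J.
(* [Q] is skew and commutes with [J], so J Q is symmetric; [A] is skew, and [flat] gives J Q = - A.
   Symmetric and skew, J Q vanishes; pairing it with itself ([W]) concludes. *)
have skew B : smooth_vf U B -> hmetric (J p (Q Z p)) (B p) = 0.
  move=> sB.
  have s1 : hmetric (J p (Q Z p)) (B p) = hmetric (Z p) (J p (Q B p)).
    rewrite hmetric_Jl hmetricDl.
    rewrite !(tangent_curvature_skew (W := j B) Up)//; try exact: smooth_J.
    by rewrite !tangent_curvature_Jr// -opprD opprK -hmetricDr -JD.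
  have a1 : hmetric (A Z p) (B p) = - hmetric (Z p) (A B p).
    by rewrite /A hmetricDl hmetricNl !(tangent_curvature_skew Up)// hmetricDr hmetricNr; ring.
  have /eqP := flat _ sZ; rewrite addr_eq0 => /eqP aZ.
  have /eqP := flat _ sB; rewrite addr_eq0 => /eqP aB.
  move: a1; rewrite aZ aB !hmetricE opprK -s1 => /eqP.
  by rewrite -subr_eq0 -opprD oppr_eq0 -mulr2n mulrn_eq0 /= => /eqP.
have /hmetric_eq0/(congr1 (J p)) := skew W sW.
by rewrite JJ J0 => /eqP; rewrite oppr_eq0 addr_eq0 => /eqP.
Qed.

(** By integrability the second argument on the left is -J([JX, Y] + [X, JY]), and T is [J]-linear
    in it. *)
Let torsion_20 X Y Z p : U p -> smooth_vf U X -> smooth_vf U Y -> smooth_vf U Z ->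
  torsion D Z (fun q => bracket X Y q - bracket (j X) (j Y) q) p =
  - J p (torsion D Z (bracket (j X) Y) p) - J p (torsion D Z (bracket X (j Y)) p).
Proof.
move=> Up sX sY sZ; have s1 := smooth_bracket oU (smooth_J sX) sY.
have s2 := smooth_bracket oU sX (smooth_J sY).
have sJ1 := smooth_J s1; have sJ2 := smooth_J s2.
have sB : smooth_vf U (fun q => bracket X Y q - bracket (j X) (j Y) q).
  by apply: smooth_vfB; apply: smooth_bracket => //; exact: smooth_J.
rewrite -!torsion_Jr// (torsionC D oU Up sZ sB).
rewrite (torsionC D oU Up sZ sJ1) (torsionC D oU Up sZ sJ2) !opprK.
rewrite (eq_torsion hD oU (X' := fun q => - (J q (bracket (j X) Y q)
  + J q (bracket X (j Y) q))) (Y' := Z) Up sB sZ)//; last first.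
  by move=> q Uq; rewrite bracket_JJ//; lmod.
rewrite (torsionNl hD oU Up (smooth_vfD sJ1 sJ2) sZ) (torsionDl hD oU)//.
by rewrite opprK.
Qed.

Let lincomb4 p (u a b c d : tangent p) :
  a = 0 -> b = 0 -> c = 0 -> d = 0 -> u = a + b + c + d -> u = 0.
Proof. by move=> -> -> -> -> ->; rewrite !addr0. Qed.

(** Encodes the Bianchi identity on X - iJX, Y - iJY, Z - iJZ. It is the sum of [first_bianchi] at
    (X, Y, Z) and of [J] applied to it at (JX, Y, Z), (X, JY, Z) and (X, Y, JZ). Where [J] falls on
    the vector the curvature acts on, J J = -1 cancels the first instance; the other curvature terms
    cancel in pairs by [tangent_curvature_J]. *)
Lemma first_bianchi_20 X Y Z p : U p -> smooth_vf U X -> smooth_vf U Y ->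
  smooth_vf U Z ->
  D p (X p) (torsion D Y Z) - J p (D p (J p (X p)) (torsion D Y Z))
    + torsion D X (fun q => bracket Y Z q - bracket (j Y) (j Z) q) p
  + (D p (Y p) (torsion D Z X) - J p (D p (J p (Y p)) (torsion D Z X))
    + torsion D Y (fun q => bracket Z X q - bracket (j Z) (j X) q) p)
  + (D p (Z p) (torsion D X Y) - J p (D p (J p (Z p)) (torsion D X Y))
    + torsion D Z (fun q => bracket X Y q - bracket (j X) (j Y) q) p) = 0.
Proof.
move=> Up sX sY sZ.
have [sJX sJY sJZ] : [/\ smooth_vf U (j X), smooth_vf U (j Y) & smooth_vf U (j Z)].
  by split; exact: smooth_J.
have Tl v (A B : vfield M) : smooth_vf U A -> smooth_vf U B ->
    D p v (torsion D (j A) B) = J p (D p v (torsion D A B)).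
  move=> sA sB; rewrite -conn_J//; last exact: (smooth_torsion hD oU).
  apply: (eq_conn hD oU) => //; last by move=> q Uq; exact: torsion_Jl.
  by apply: (smooth_torsion hD oU) => //; exact: smooth_J.
have Tr v (A B : vfield M) : smooth_vf U A -> smooth_vf U B ->
    D p v (torsion D A (j B)) = J p (D p v (torsion D A B)).
  move=> sA sB; rewrite -conn_J//; last exact: (smooth_torsion hD oU).
  apply: (eq_conn hD oU) => //; last by move=> q Uq; exact: torsion_Jr.
  by apply: (smooth_torsion hD oU) => //; exact: smooth_J.
have sB := smooth_bracket oU; rewrite !torsion_20//.
(* Hides the bodies of the two definitions from the rewriting with [JE]. *)
have [t tE] : exists t, t = torsion D by exists (torsion D).
have [c cE] : exists c, c = tangent_curvature D by exists (tangent_curvature D).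
have /eqP := first_bianchi hD oU Up sX sY sZ; rewrite -subr_eq0 -cE -tE => /eqP b0.
have /eqP := first_bianchi hD oU Up sJX sY sZ; rewrite -subr_eq0.
rewrite tangent_curvature_J// tangent_curvature_Jr// Tl// Tr//.
rewrite torsion_Jl//; last exact: sB.
rewrite -cE -tE => /eqP/(congr1 (J p)); rewrite J0 !JE => b1.
have /eqP := first_bianchi hD oU Up sX sJY sZ; rewrite -subr_eq0.
rewrite tangent_curvature_J// tangent_curvature_Jr// Tl// Tr//.
rewrite torsion_Jl//; last exact: sB.
rewrite -cE -tE => /eqP/(congr1 (J p)); rewrite J0 !JE => b2.
have /eqP := first_bianchi hD oU Up sX sY sJZ; rewrite -subr_eq0.
rewrite tangent_curvature_J// tangent_curvature_Jr// Tl// Tr//.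
rewrite torsion_Jl//; last exact: sB.
rewrite -cE -tE => /eqP/(congr1 (J p)); rewrite J0 !JE => b3.
by apply: (lincomb4 b0 b1 b2 b3); lmod.
Qed.

(** Makes the tangent space a complex vector space with [J] as multiplication by i, without a second
    module structure on its type. *)
Definition hscale p (c : R[i]) (v : tangent p) : tangent p :=
  complex.Re c *: v + complex.Im c *: J p v.

Lemma hscale_addl p (c c' : R[i]) (v : tangent p) :
  hscale (c + c') v = hscale c v + hscale c' v.
Proof. by case: c c' => [a b] [a' b']; rewrite /hscale /=; lmod. Qed.

Lemma hscale_addr p (c : R[i]) (v w : tangent p) :
  hscale c (v + w) = hscale c v + hscale c w.
Proof. by rewrite /hscale !JE; lmod. Qed.

Lemma hscaleN p (c : R[i]) (v : tangent p) : hscale (- c) v = - hscale c v.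
Proof. by case: c => [a b]; rewrite /hscale /=; lmod. Qed.

Lemma hscaleA p (c c' : R[i]) (v : tangent p) :
  hscale c (hscale c' v) = hscale (c * c') v.
Proof. by case: c c' => [a b] [a' b']; rewrite /hscale /= !JE; lmod. Qed.

Lemma hscale_sumr p (c : R[i]) (I : Type) (r : seq I) (v : I -> tangent p) :
  hscale c (\sum_(i <- r) v i) = \sum_(i <- r) hscale c (v i).
Proof.
elim: r => [|i r IH]; last by rewrite !big_cons hscale_addr IH.
by rewrite !big_nil /hscale J0 !scaler0 addr0.
Qed.

(* A unitary frame, given by its members of odd index: the others are their
   images under [J]. *)
Record complex_frame (x : 'I_n -> vfield M) : Prop := ComplexFrame {
  cf_smooth : forall l, smooth_vf U (x l);
  cf_orthonormal : forall p, U p -> forall l k,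
    hmetric (x l p) (x k p) = (l == k)%:R;
  cf_orthogonal : forall p, U p -> forall l k, hmetric (x l p) (J p (x k p)) = 0;
  cf_span : forall p, U p -> forall v : tangent p, exists a b : 'I_n -> R,
    v = \sum_l (a l *: x l p + b l *: J p (x l p)) }.

(** The Hermitian product g(v, x_l) + i g(v, J x_l), complex linear in [v]; it is also the bilinear
    product of [z10 v] and [z01] of x_l, hence the scalar of the Clifford relation. *)
Definition hcoord (x : 'I_n -> vfield M) p (l : 'I_n) (v : tangent p) : R[i] :=
  Complex (hmetric v (x l p)) (hmetric v (J p (x l p))).

Lemma hcoordD x p l (v w : tangent p) : hcoord x l (v + w) = hcoord x l v + hcoord x l w.
Proof. by rewrite /hcoord !hmetricDl. Qed.

Lemma hcoordN x p l (v : tangent p) : hcoord x l (- v) = - hcoord x l v.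
Proof. by rewrite /hcoord !hmetricNl. Qed.

Lemma hcoord_hscale x p l (c : R[i]) (v : tangent p) :
  hcoord x l (hscale c v) = c * hcoord x l v.
Proof.
case: c => [a b]; apply/eqP; rewrite eq_complex /= /hscale /= !hmetricE !hmetric_Jl JJ.
by rewrite hmetricNr; apply/andP; split; apply/eqP; ring.
Qed.

Section Frame.
Variable x : 'I_n -> vfield M.
Hypothesis hx : complex_frame x.

Lemma frame_expand p (v : tangent p) : U p ->
  v = \sum_l hscale (hcoord x l v) (x l p).
Proof.
move=> Up; have [a [b vE]] := cf_span hx Up v.
rewrite {1}vE; apply: eq_bigr => l _; rewrite /hscale /=.
suff [-> ->] : hmetric v (x l p) = a l /\ hmetric v (J p (x l p)) = b l by [].
split.
- rewrite vE hmetric_sym hmetric_sumr (bigD1 l)//= big1.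
    rewrite addr0 !hmetricE (cf_orthonormal hx)// (cf_orthogonal hx)// eqxx.
    by rewrite mulr1 mulr0 addr0.
  move=> k kl; rewrite !hmetricE (cf_orthonormal hx)// (cf_orthogonal hx)//.
  by rewrite eq_sym (negPf kl) !mulr0 addr0.
- rewrite vE hmetric_sym hmetric_sumr (bigD1 l)//= big1.
    rewrite addr0 !hmetricE (hs_isometry hJ) hmetric_sym (cf_orthogonal hx)//.
    by rewrite (cf_orthonormal hx)// eqxx mulr1 mulr0 add0r.
  move=> k kl; rewrite !hmetricE (hs_isometry hJ) hmetric_sym (cf_orthogonal hx)//.
  by rewrite (cf_orthonormal hx)// eq_sym (negPf kl) !mulr0 addr0.
Qed.

(** [torsion] takes fields, so [X] has to be expanded with smooth coefficients on all of [U];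
    tensoriality then extracts their values at [p]. *)
Lemma torsion_frame_expand X Y p : U p -> smooth_vf U X -> smooth_vf U Y ->
  torsion D X Y p = \sum_l hscale (hcoord x l (X p)) (torsion D (x l) Y p).
Proof.
move=> Up sX sY; have sx := cf_smooth hx; have sJx l := smooth_J (sx l).
have sg (A B : vfield M) : smooth_vf U A -> smooth_vf U B ->
    smooth_on U (fun q => hmetric (A q) (B q)) by exact: hmetric_smooth.
have s1 l := smooth_vfM (sg _ _ sX (sx l)) (sx l).
have s2 l := smooth_vfM (sg _ _ sX (sJx l)) (sJx l).
pose F l : vfield M := fun q => hmetric (X q) (x l q) *: x l q
  + hmetric (X q) (J q (x l q)) *: J q (x l q).
have sF l : smooth_vf U (F l) by exact: smooth_vfD.
rewrite (eq_torsion hD oU (X' := fun q => \sum_l F l q) (Y' := Y) Up sX sY)//; last first.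
  by move=> q Uq; exact: frame_expand.
rewrite (torsion_suml hD oU)//; apply: eq_bigr => l _.
by rewrite (torsionDl hD oU)// !(torsionMl hD oU)//; try exact: sg; rewrite torsion_Jl.
Qed.

(** Extends the torsion to single vectors, with no choice of fields extending them. *)
Definition torsion_tensor p (v w : tangent p) : tangent p :=
  \sum_l \sum_k hscale (hcoord x l v * hcoord x k w) (torsion D (x l) (x k) p).

Lemma torsion_tensorE X Y p : U p -> smooth_vf U X -> smooth_vf U Y ->
  torsion D X Y p = torsion_tensor (X p) (Y p).
Proof.
move=> Up sX sY; have sx := cf_smooth hx.
rewrite (torsion_frame_expand Up sX sY); apply: eq_bigr => l _.
rewrite (torsionC D oU Up (sx l) sY) (torsion_frame_expand Up sY (sx l)).
rewrite -sumrN hscale_sumr; apply: eq_bigr => k _.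
rewrite (torsionC D oU Up (sx k) (sx l)) -hscaleN -hscaleA; congr hscale.
by rewrite /hscale !JE /=; lmod.
Qed.

Lemma torsion_tensorDl p (u v w : tangent p) :
  torsion_tensor (u + v) w = torsion_tensor u w + torsion_tensor v w.
Proof.
rewrite /torsion_tensor -big_split; apply: eq_bigr => l _ /=.
rewrite -big_split; apply: eq_bigr => k _ /=.
by rewrite hcoordD mulrDl hscale_addl.
Qed.

Lemma torsion_tensorNl p (u w : tangent p) :
  torsion_tensor (- u) w = - torsion_tensor u w.
Proof.
rewrite /torsion_tensor -sumrN; apply: eq_bigr => l _ /=.
rewrite -sumrN; apply: eq_bigr => k _ /=.
by rewrite hcoordN mulNr hscaleN.
Qed.

Lemma torsion_tensor_hscale p (c : R[i]) (u w : tangent p) :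
  torsion_tensor (hscale c u) w = hscale c (torsion_tensor u w).
Proof.
rewrite /torsion_tensor hscale_sumr; apply: eq_bigr => l _ /=.
rewrite hscale_sumr; apply: eq_bigr => k _ /=.
by rewrite hcoord_hscale -mulrA hscaleA.
Qed.

Lemma torsion_tensorC p (v w : tangent p) : U p ->
  torsion_tensor v w = - torsion_tensor w v.
Proof.
move=> Up; have sx := cf_smooth hx.
rewrite /torsion_tensor exchange_big -sumrN; apply: eq_bigr => l _ /=.
rewrite -sumrN; apply: eq_bigr => k _ /=.
rewrite (torsionC D oU Up (sx k) (sx l)) mulrC.
by rewrite /hscale !JE /=; lmod.
Qed.

End Frame.
End Structure.
End HermitianGeometry.

(** * Sections and the Clifford action *)

Section Sections.
Context {R : realType} {m : nat} {M : manifold R m} {E : vbundle M}.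
Implicit Types (U : set M) (p : M) (s t : section E).

Lemma csmooth_on_sub (U V : set M) (f : M -> R[i]) :
  V `<=` U -> csmooth_on U f -> csmooth_on V f.
Proof. by move=> VU [sr si]; split; exact: smooth_on_sub VU _. Qed.

Lemma eq_csmooth_on (U : set M) (f g : M -> R[i]) : open U ->
  (forall q, U q -> f q = g q) -> csmooth_on U f -> csmooth_on U g.
Proof.
by move=> oU fg [sr si]; split; [apply: eq_smooth_on sr|apply: eq_smooth_on si] => //;
  move=> q Uq; rewrite fg.
Qed.

Lemma csmooth_on_cst (U : set M) (c : R[i]) : csmooth_on U (fun _ : M => c).
Proof. by split; exact: smooth_on_cst. Qed.

Lemma smooth_sec_sub (U V : set M) s : V `<=` U -> smooth_sec U s -> smooth_sec V s.
Proof.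
move=> VU ss t ht i; apply: csmooth_on_sub (ss t ht i).
by move=> q [/VU].
Qed.

Lemma eq_smooth_sec U s t : open U -> (forall q, U q -> s q = t q) ->
  smooth_sec U s -> smooth_sec U t.
Proof.
move=> oU st ss u hu i; apply: eq_csmooth_on (ss u hu i).
  by apply: openI => //; exact: tdom_open.
by move=> q [Uq _]; rewrite st.
Qed.

Lemma smooth_sec_lin U (c : R[i]) s t : open U -> smooth_sec U s ->
  smooth_sec U t -> smooth_sec U (fun q => c *: s q + t q).
Proof.
move=> oU ss st u hu i; have [sr si] := ss u hu i; have [tr ti] := st u hu i.
have oV : open (U `&` tdom u) by apply: openI => //; exact: tdom_open.
split.
- apply: (@eq_smooth_on _ _ _ _ (fun q => complex.Re c * complex.Re (tmap u (s q) 0 i)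
    - complex.Im c * complex.Im (tmap u (s q) 0 i) + complex.Re (tmap u (t q) 0 i))) => //.
    move=> q [_ uq]; rewrite tmap_lin// !mxE.
    by case: c (tmap u (s q) 0 i) (tmap u (t q) 0 i) => [a b] [a1 b1] [a2 b2].
  by apply: smooth_onD => //; apply: smooth_onB => //; apply: smooth_onM => //;
    exact: smooth_on_cst.
- apply: (@eq_smooth_on _ _ _ _ (fun q => complex.Re c * complex.Im (tmap u (s q) 0 i)
    + complex.Im c * complex.Re (tmap u (s q) 0 i) + complex.Im (tmap u (t q) 0 i))) => //.
    move=> q [_ uq]; rewrite tmap_lin// !mxE.
    by case: c (tmap u (s q) 0 i) (tmap u (t q) 0 i) => [a b] [a1 b1] [a2 b2].
  by apply: smooth_onD => //; apply: smooth_onD => //; apply: smooth_onM => //;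
    exact: smooth_on_cst.
Qed.

Lemma smooth_sec0 U : open U -> smooth_sec U (fun q => 0 : E q).
Proof.
move=> oU u hu i; apply: eq_csmooth_on (csmooth_on_cst (U `&` tdom u) 0).
  by apply: openI => //; exact: tdom_open.
move=> q [_ uq]; have /eqP := tmap_lin uq 1 0 0.
rewrite !scale1r addr0 -subr_eq subrr => /eqP <-.
by rewrite mxE.
Qed.

Lemma smooth_secZ U (c : R[i]) s : open U -> smooth_sec U s ->
  smooth_sec U (fun q => c *: s q).
Proof.
move=> oU ss; apply: eq_smooth_sec (smooth_sec_lin c oU ss (smooth_sec0 oU)) => //.
by move=> q _; rewrite addr0.
Qed.

Lemma smooth_secD U s t : open U -> smooth_sec U s -> smooth_sec U t ->
  smooth_sec U (fun q => s q + t q).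
Proof.
move=> oU ss st; apply: eq_smooth_sec (smooth_sec_lin 1 oU ss st) => //.
by move=> q _; rewrite scale1r.
Qed.

Lemma smooth_secB U s t : open U -> smooth_sec U s -> smooth_sec U t ->
  smooth_sec U (fun q => s q - t q).
Proof.
move=> oU ss st; apply: eq_smooth_sec (smooth_sec_lin (-1) oU st ss) => //.
by move=> q _; rewrite scaleN1r addrC.
Qed.

Lemma smooth_sec_sum U (I : Type) (r : seq I) (s : I -> section E) : open U ->
  (forall i, smooth_sec U (s i)) -> smooth_sec U (fun q => \sum_(i <- r) s i q).
Proof.
move=> oU ss; elim: r => [|i r IH].
  by apply: eq_smooth_sec (smooth_sec0 oU) => // q _; rewrite big_nil.
by apply: eq_smooth_sec (smooth_secD oU (ss i) IH) => // q _; rewrite big_cons.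
Qed.

Section Connection.
Variables (D : connection E) (U : set M).
Arguments D : clear implicits.
Hypotheses (hD : is_connection (@smooth_sec _ _ _ E) D) (oU : open U).

Lemma sec_dirD p (v w : tangent p) s : U p -> smooth_sec U s ->
  D p (v + w) s = D p v s + D p w s.
Proof.
by move=> Up ss; have := conn_lin hD oU Up ss 1 v w; rewrite !scale1r.
Qed.

Lemma sec_dirZ p (a : R) (v : tangent p) s : U p -> smooth_sec U s ->
  D p (a *: v) s = a%:C%C *: D p v s.
Proof.
move=> Up ss; have /eqP := sec_dirD 0 0 Up ss.
rewrite addr0 -subr_eq subrr eq_sym => /eqP D0.
by have := conn_lin hD oU Up ss a v 0; rewrite D0 !addr0.
Qed.

Lemma sec_dirN p (v : tangent p) s : U p -> smooth_sec U s -> D p (- v) s = - D p v s.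
Proof.
by move=> Up ss; rewrite -(scaleN1r v) sec_dirZ// rmorphN1 scaleN1r.
Qed.

Lemma secD p (v : tangent p) s t : U p -> smooth_sec U s -> smooth_sec U t ->
  D p v (fun q => s q + t q) = D p v s + D p v t.
Proof. by move=> Up ss st; exact: (conn_add hD oU Up). Qed.

Lemma secZ p (v : tangent p) (c : R[i]) s : U p -> smooth_sec U s ->
  D p v (fun q => c *: s q) = c *: D p v s.
Proof.
move=> Up ss; rewrite (conn_leibniz hD oU Up (csmooth_on_cst U c) ss).
by rewrite /cderiv !tangent_cst scale0r add0r.
Qed.

Lemma sec_eq p (v : tangent p) s t : U p -> smooth_sec U s ->
  (forall q, U q -> s q = t q) -> D p v s = D p v t.
Proof.
by move=> Up ss st; apply: (conn_local hD oU) => //; exact: eq_smooth_sec ss.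
Qed.

Lemma smooth_sec_conn (X : vfield M) s : smooth_vf U X -> smooth_sec U s ->
  smooth_sec U (fun q => D q (X q) s).
Proof. exact: (conn_smooth hD). Qed.

End Connection.
End Sections.

Section CliffordAction.
Context {R : realType} {n : nat} {M : hermitian_manifold R n}.
Context {Cl : clifford_bundle M} {DCl : cl_connection Cl}.
Variable E : chern_dirac_bundle DCl.
Implicit Types (p : M) (X Y : vfield M) (s : section E).

Local Open Scope complex_scope.

Lemma cl_inD p (v w : tangent p) : cl_in Cl (v + w) = cl_in Cl v + cl_in Cl w.
Proof.
by have [/(_ 1 v w)] := @cl_inP _ _ _ Cl p; rewrite !scale1r.
Qed.

Lemma cl_inZ p (a : R) (v : tangent p) : cl_in Cl (a *: v) = a%:C *: cl_in Cl v.
Proof.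
have [cl_lin _] := @cl_inP _ _ _ Cl p; have /eqP := cl_inD 0 (0 : tangent p).
rewrite addr0 -subr_eq subrr eq_sym => /eqP cl0.
by have := cl_lin a v 0; rewrite cl0 !addr0.
Qed.

Lemma cd_c_is_linear p (w : Cl p) : linear (cd_c w : E p -> E p).
Proof. by move=> a x y; exact: cd_c_linr. Qed.

HB.instance Definition _ p (w : Cl p) :=
  GRing.isLinear.Build R[i] (E p) (E p) *:%R (cd_c w) (cd_c_is_linear w).

Lemma cd_cD p (u w : Cl p) (y : E p) : cd_c (u + w) y = cd_c u y + cd_c w y.
Proof. by have := cd_c_linl 1 u w y; rewrite !scale1r. Qed.

Lemma cd_cZ p (a : R[i]) (w : Cl p) (y : E p) : cd_c (a *: w) y = a *: cd_c w y.
Proof.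
have /eqP := cd_cD 0 0 y; rewrite addr0 -subr_eq subrr eq_sym => /eqP c0.
by have := cd_c_linl a w 0 y; rewrite c0 !addr0.
Qed.

Definition clm p (v : tangent p) (y : E p) : E p := cd_c (cl_in Cl v) y.

Lemma clmD p (v w : tangent p) (y : E p) : clm (v + w) y = clm v y + clm w y.
Proof. by rewrite /clm cl_inD cd_cD. Qed.

Lemma clmZ p (a : R) (v : tangent p) (y : E p) : clm (a *: v) y = a%:C *: clm v y.
Proof. by rewrite /clm cl_inZ cd_cZ. Qed.

Lemma clmN p (v : tangent p) (y : E p) : clm (- v) y = - clm v y.
Proof. by rewrite -(scaleN1r v) clmZ rmorphN1 scaleN1r. Qed.

Lemma clm_addr p (v : tangent p) (y z : E p) : clm v (y + z) = clm v y + clm v z.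
Proof. exact: linearD. Qed.

Lemma clm_oppr p (v : tangent p) (y : E p) : clm v (- y) = - clm v y.
Proof. exact: linearN. Qed.

Lemma clm_scaler p (v : tangent p) (a : R[i]) (y : E p) : clm v (a *: y) = a *: clm v y.
Proof. exact: linearZ. Qed.

Lemma clmC p (v w : tangent p) (y : E p) :
  clm w (clm v y) = - clm v (clm w y) + (- 2 * hmetric v w)%:C *: y.
Proof.
have [_ /(_ v w) clE] := @cl_inP _ _ _ Cl p.
have := congr1 (fun u => cd_c u y) clE.
rewrite cd_cD !cd_c_mul cd_cZ cd_c_one -/(clm v _) -/(clm w _) => <-.
by rewrite addrA addNr add0r.
Qed.

Definition clmE := (clmD, clmZ, clmN, clm_addr, clm_oppr, clm_scaler).

Lemma smooth_cl_vf (U : set M) X : open U -> smooth_vf U X ->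
  smooth_cl U (fun q => cl_in Cl (X q)).
Proof.
move=> oU sX p Up; exists U; split=> //.
exists 1%N, (fun _ _ => 1), (fun=> 1%N), (fun _ _ => X); split=> //.
- by move=> _; exact: csmooth_on_cst.
- by move=> q _; rewrite !big_ord1 scale1r.
Qed.

Lemma smooth_clm (U : set M) X s : open U -> smooth_vf U X -> smooth_sec U s ->
  smooth_sec U (fun q => clm (X q) (s q)).
Proof. by move=> oU sX ss; apply: cd_c_smooth => //; exact: smooth_cl_vf. Qed.

Lemma clm_parallel (D : tconnection M) (U : set M) X Y s p :
  is_induced D DCl -> open U -> U p -> smooth_vf U X -> smooth_vf U Y ->
  smooth_sec U s ->
  cd_D (X p) (fun q => clm (Y q) (s q)) =
  clm (D p (X p) Y) (s p) + clm (Y p) (cd_D (X p) s).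
Proof.
move=> hDCl oU Up sX sY ss; rewrite (cd_c_parallel oU Up sX _ ss).
  by rewrite (induced_vf hDCl oU Up sY).
exact: smooth_cl_vf.
Qed.

(** * Clifford multiplication by vectors of type (1,0) and (0,1) *)

Section Types.
Variables (D : tconnection M) (J : forall p : M, tangent p -> tangent p).
Arguments D : clear implicits.
Arguments J : clear implicits.
Hypothesis hJ : hermitian_structure D J.

Let r : R := (Num.sqrt 2)^-1.

Let rr : r * r = 2^-1.
Proof. by rewrite -invfM -expr2 sqr_sqrtr. Qed.

Let rC : r%:C * r%:C = 2^-1 :> R[i].
Proof. by rewrite -rmorphM /= rr fmorphV rmorphMn rmorph1. Qed.

Let ii : 'i * 'i = -1 :> R[i].
Proof. by rewrite -expr2 sqr_i. Qed.

Let cE (a b : R) : a +i* b = a%:C + 'i * b%:C.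
Proof. exact: (complexE (a +i* b)). Qed.

Definition z10 p (v : tangent p) : ctangent p :=
  r *: ((v, - J p v) : tangent p * tangent p).

Definition z01 p (v : tangent p) : ctangent p :=
  r *: ((v, J p v) : tangent p * tangent p).

Definition chol p (v : tangent p) (y : E p) : E p := cd_c (cl_inC (z10 v)) y.

Definition canti p (v : tangent p) (y : E p) : E p := cd_c (cl_inC (z01 v)) y.

HB.instance Definition _ p (v : tangent p) := GRing.Linear.copy (chol v) (cd_c (cl_inC (z10 v))).
HB.instance Definition _ p (v : tangent p) := GRing.Linear.copy (canti v) (cd_c (cl_inC (z01 v))).

Definition chol_l p v : {linear E p -> E p} := chol v.

Definition canti_l p v : {linear E p -> E p} := canti v.

Lemma cholE p (v : tangent p) (y : E p) :
  chol v y = r%:C *: (clm v y - 'i *: clm (J p v) y).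
Proof.
rewrite /chol /cl_inC cd_cD cd_cZ -/(clm _ _) -/(clm _ _) !clmZ clmN.
by rewrite /=; lmod.
Qed.

Lemma cantiE p (v : tangent p) (y : E p) :
  canti v y = r%:C *: (clm v y + 'i *: clm (J p v) y).
Proof.
rewrite /canti /cl_inC cd_cD cd_cZ -/(clm _ _) -/(clm _ _) !clmZ.
by rewrite /=; lmod.
Qed.

Lemma cholB p (v w : tangent p) (y : E p) : chol (v - w) y = chol v y - chol w y.
Proof. by rewrite !cholE !(JE hJ) !clmE; lmod. Qed.

Lemma cholD p (v w : tangent p) (y : E p) : chol (v + w) y = chol v y + chol w y.
Proof. by rewrite !cholE !(JE hJ) !clmE; lmod. Qed.

Lemma cantiD p (v w : tangent p) (y : E p) : canti (v + w) y = canti v y + canti w y.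
Proof. by rewrite !cantiE !(JE hJ) !clmE; lmod. Qed.

Lemma chol_hscale p (c : R[i]) (v : tangent p) (y : E p) :
  chol (hscale J c v) y = c *: chol v y.
Proof.
case: c => [a b]; rewrite !cholE /hscale /= !(JE hJ) !clmE.
rewrite (cE a b).
by lmod_coefs; ring: ii.
Qed.

(** [z01] is conjugate linear for [J], since [z01 (J v)] is -i times [z01 v]. *)
Lemma canti_hscale p (c : R[i]) (v : tangent p) (y : E p) :
  canti (hscale J c v) y = c^* *: canti v y.
Proof.
case: c => [a b]; rewrite !cantiE /hscale /= !(JE hJ) !clmE.
rewrite [X in _ = X *: _](_ : _ = a%:C - 'i * b%:C).
  by lmod_coefs; ring: ii.
by rewrite -mulrN -rmorphN; exact: (cE a (- b)).
Qed.

(** The (1,0)-vectors are isotropic for the bilinear extension of g, so the Clifford relation loses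
    its scalar term. *)
Lemma cholC p (v w : tangent p) (y : E p) :
  chol v (chol w y) = - chol w (chol v y).
Proof.
rewrite !cholE !clmE (clmC v w) (clmC (J p v) w) (clmC v (J p w)) (clmC (J p v) (J p w)).
rewrite (hs_isometry hJ) (hmetric_Jl hJ).
rewrite !rmorphM !rmorphN /=.
by lmod_coefs; ring: ii.
Qed.

Lemma cantiC p (v w : tangent p) (y : E p) :
  canti v (canti w y) = - canti w (canti v y).
Proof.
rewrite !cantiE !clmE (clmC v w) (clmC (J p v) w) (clmC v (J p w)) (clmC (J p v) (J p w)).
rewrite (hs_isometry hJ) (hmetric_Jl hJ).
rewrite !rmorphM !rmorphN /=.
by lmod_coefs; ring: ii.
Qed.

Lemma chol_canti p (v w : tangent p) (y : E p) :
  chol v (canti w y) =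
  - canti w (chol v y) - (2 * (hmetric v w +i* hmetric v (J p w))) *: y.
Proof.
rewrite !cantiE !cholE !clmE.
rewrite (clmC v w) (clmC (J p v) w) (clmC v (J p w)) (clmC (J p v) (J p w)).
rewrite (hs_isometry hJ) (hmetric_Jl hJ) (cE (hmetric v w) (hmetric v (J p w))).
rewrite !rmorphM !rmorphN /= ?rmorph_nat.
have r2 : 2 * (r%:C * r%:C) = 1 by rewrite rC mulfV.
lmod_coefs; try ring: ii.
(* The scalar produced by the four Clifford relations is off by the factor 2 r^2, which is 1; [ring]
   needs it isolated. *)
transitivity ((2 * (r%:C * r%:C) - 1) *
    (2 * ((hmetric v w)%:C + 'i * (hmetric v (J p w))%:C))); last by ring: ii.
by rewrite r2 subrr; ring.
Qed.

Lemma hcoord_herm (x x' : 'I_n -> vfield M) p j k :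
  (hcoord J x' k (x j p))^*%R = hcoord J x j (x' k p).
Proof.
rewrite /hcoord (hmetric_sym (x' k p) (x j p)) (hmetric_sym (x' k p)).
by rewrite (hmetric_Jl hJ).
Qed.

Lemma chol_sum p (c : 'I_n -> R[i]) (v : 'I_n -> tangent p) (y : E p) :
  chol (\sum_l hscale J (c l) (v l)) y = \sum_l c l *: chol (v l) y.
Proof.
have c0 : chol 0 y = 0 by rewrite -(subrr 0) cholB subrr.
elim/big_rec2: _ => // l z1 z2 _ <-.
by rewrite cholD chol_hscale.
Qed.

Lemma canti_sum p (c : 'I_n -> R[i]) (v : 'I_n -> tangent p) (y : E p) :
  canti (\sum_l hscale J (c l) (v l)) y = \sum_l (c l)^* *: canti (v l) y.
Proof.
have c0 : canti 0 y = 0.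
  have /eqP := cantiD 0 0 y; rewrite addr0 -subr_eq subrr eq_sym => /eqP//.
elim/big_rec2: _ => // l z1 z2 _ <-.
by rewrite cantiD canti_hscale.
Qed.

(** The trace of a sesquilinear map: expanding the first slot on the left in [x'] and the second
    slot on the right in [x] gives the same double sum, because the transition matrices are
    conjugate transposes ([hcoord_herm]). *)
Lemma frame_trace_independent (S : lmodType R[i]) (U U' : set M)
    (x x' : 'I_n -> vfield M) p (F : tangent p -> tangent p -> S) :
  complex_frame J U x -> complex_frame J U' x' -> U p -> U' p ->
  (forall c v w, F (\sum_l hscale J (c l) (v l)) w = \sum_(l < n) (c l)^* *: F (v l) w) ->
  (forall c v w, F w (\sum_l hscale J (c l) (v l)) = \sum_(l < n) c l *: F w (v l)) ->
  \sum_j F (x j p) (x j p) = \sum_k F (x' k p) (x' k p).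
Proof.
move=> hx hx' Up Up' Fl Fr.
under eq_bigr => j _ do rewrite {1}(frame_expand hJ hx' (x j p) Up') Fl.
under [RHS]eq_bigr => k _ do rewrite {2}(frame_expand hJ hx (x' k p) Up) Fr.
rewrite exchange_big; apply: eq_bigr => k _; apply: eq_bigr => j _.
by rewrite hcoord_herm.
Qed.

End Types.
End CliffordAction.

(** * Partial Chern-Dirac operators *)

Section CovariantDerivative.
Context {R : realType} {n : nat} {M : hermitian_manifold R n}.
Context {Cl : clifford_bundle M} {DCl : cl_connection Cl}.
Variables (E : chern_dirac_bundle DCl) (D : tconnection M).
Variables (J : forall p : M, tangent p -> tangent p) (U : set M).
Arguments D : clear implicits.
Arguments J : clear implicits.
Hypotheses (hJ : hermitian_structure D J) (hDCl : is_induced D DCl) (oU : open U).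
Implicit Types (p : M) (X Y : vfield M) (s t : section E).

Local Open Scope complex_scope.
Local Notation hD := (hs_conn hJ).
Local Notation hE := (cd_connection E).
Local Notation "'j' X" := (fun q => J q (X q)) (at level 10, X at level 9).

Let r : R := (Num.sqrt 2)^-1.

Let rr : r * r = 2^-1.
Proof. by rewrite -invfM -expr2 sqr_sqrtr. Qed.

Let ii : 'i * 'i = -1 :> R[i].
Proof. by rewrite -expr2 sqr_i. Qed.

Let rsmooth X : smooth_vf U X -> smooth_vf U (j X).
Proof. exact: (smooth_J hJ oU). Qed.

Lemma cd_DC_z10 p (v : tangent p) s : U p -> smooth_sec U s ->
  cd_DC (z10 J v) s = r%:C *: (cd_D v s - 'i *: cd_D (J p v) s).
Proof.
move=> Up ss; rewrite /cd_DC /= -/r scalerN -scaleNr !(sec_dirZ hE oU)// rmorphN /=.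
by lmod.
Qed.

Lemma cd_DC_D p (v w : tangent p) s : U p -> smooth_sec U s ->
  cd_DC (z10 J (v + w)) s = cd_DC (z10 J v) s + cd_DC (z10 J w) s.
Proof. by move=> Up ss; rewrite !cd_DC_z10// !(JE hJ) !(sec_dirD hE oU)//; lmod. Qed.

Lemma cd_DC_hscale p (c : R[i]) (v : tangent p) s : U p -> smooth_sec U s ->
  cd_DC (z10 J (hscale J c v)) s = c *: cd_DC (z10 J v) s.
Proof.
move=> Up ss; rewrite !cd_DC_z10// /hscale !(JE hJ) !(sec_dirD hE oU)//.
rewrite scalerN -!scaleNr !(sec_dirZ hE oU)// rmorphN.
case: c => [a b] /=; have -> : a +i* b = a%:C + 'i * b%:C by exact: (complexE (a +i* b)).
by lmod_coefs; ring: ii.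
Qed.

Lemma cd_DC_N p (v : tangent p) s : U p -> smooth_sec U s ->
  cd_DC (z10 J (- v)) s = - cd_DC (z10 J v) s.
Proof.
move=> Up ss; rewrite -[RHS]scaleN1r -cd_DC_hscale//; congr (cd_DC (z10 J _) s).
by rewrite hscaleN /hscale /= scale0r addr0 scale1r.
Qed.

Lemma cd_DC_sum p (c : 'I_n -> R[i]) (v : 'I_n -> tangent p) s : U p ->
  smooth_sec U s ->
  cd_DC (z10 J (\sum_l hscale J (c l) (v l))) s = \sum_l c l *: cd_DC (z10 J (v l)) s.
Proof.
move=> Up ss; have c0 : cd_DC (z10 J (0 : tangent p)) s = 0.
  apply: (addrI (cd_DC (z10 J (0 : tangent p)) s)).
  by rewrite -cd_DC_D// !addr0.
elim/big_rec2: _ => // l z1 z2 _ <-.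
by rewrite cd_DC_D// cd_DC_hscale.
Qed.

Lemma smooth_cd_DC X s : smooth_vf U X -> smooth_sec U s ->
  smooth_sec U (fun q => cd_DC (z10 J (X q)) s).
Proof.
move=> sX ss; apply: (@eq_smooth_sec _ _ _ E _
  (fun q => r%:C *: (cd_D (X q) s - 'i *: cd_D (J q (X q)) s))) => //.
  by move=> q Uq; rewrite cd_DC_z10.
apply: smooth_secZ => //; apply: smooth_secB => //.
  exact: (smooth_sec_conn hE oU).
apply: smooth_secZ => //; apply: (smooth_sec_conn hE oU) => //.
exact: rsmooth.
Qed.

Lemma cd_DC_secD p (z : ctangent p) s t : U p -> smooth_sec U s -> smooth_sec U t ->
  cd_DC z (fun q => s q + t q) = cd_DC z s + cd_DC z t.
Proof. by move=> Up ss st; rewrite /cd_DC !(secD hE oU)//; lmod. Qed.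

Lemma cd_DC_secZ p (z : ctangent p) (c : R[i]) s : U p -> smooth_sec U s ->
  cd_DC z (fun q => c *: s q) = c *: cd_DC z s.
Proof. by move=> Up ss; rewrite /cd_DC !(secZ hE oU)//; lmod. Qed.

Lemma eq_cd_DC p (z : ctangent p) s t : U p -> smooth_sec U s ->
  (forall q, U q -> s q = t q) -> cd_DC z s = cd_DC z t.
Proof.
by move=> Up ss st; rewrite /cd_DC (sec_eq hE oU _ Up ss st)
  (sec_eq hE oU z.2 Up ss st).
Qed.

Lemma cd_DC_secB p (z : ctangent p) s t : U p -> smooth_sec U s -> smooth_sec U t ->
  cd_DC z (fun q => s q - t q) = cd_DC z s - cd_DC z t.
Proof.
move=> Up ss st; rewrite -[X in _ = _ + X]scaleN1r -cd_DC_secZ// -cd_DC_secD//.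
  apply: eq_cd_DC => //; first exact: smooth_secB.
  by move=> q _; rewrite scaleN1r.
exact: smooth_secZ.
Qed.

Lemma cd_DC_sec_sum p (z : ctangent p) (I : Type) (l : seq I) (s : I -> section E) :
  U p -> (forall k, smooth_sec U (s k)) ->
  cd_DC z (fun q => \sum_(k <- l) s k q) = \sum_(k <- l) cd_DC z (s k).
Proof.
move=> Up ss; elim: l => [|k l IH].
  have s0 := @smooth_sec0 _ _ _ E U oU.
  rewrite big_nil -[RHS](scale0r (cd_DC z (fun q => 0 : E q))) -cd_DC_secZ//.
  apply: eq_cd_DC => //; last by move=> q _; rewrite big_nil scale0r.
  by apply: eq_smooth_sec s0 => // q _; rewrite big_nil.
rewrite big_cons -IH -cd_DC_secD//; last exact: smooth_sec_sum.
apply: eq_cd_DC => //; first exact: smooth_sec_sum.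
by move=> q _; rewrite big_cons.
Qed.

Lemma chol_J p (v : tangent p) (y : E p) : chol J (J p v) y = 'i *: chol J v y.
Proof.
rewrite -(chol_hscale hJ); congr (chol J _ y).
by rewrite /hscale /= scale0r add0r scale1r.
Qed.

Lemma canti_J p (v : tangent p) (y : E p) : canti J (J p v) y = - 'i *: canti J v y.
Proof.
have -> : J p v = hscale J 'i v by rewrite /hscale /= scale0r add0r scale1r.
rewrite (canti_hscale hJ); congr (_ *: _).
by apply/eqP; rewrite eq_complex /= oppr0 !eqxx.
Qed.

Lemma cholZ p (a : R) (v : tangent p) (y : E p) : chol J (a *: v) y = a%:C *: chol J v y.
Proof. by rewrite !cholE !(JE hJ) !clmE; lmod. Qed.

Lemma cantiZ p (a : R) (v : tangent p) (y : E p) : canti J (a *: v) y = a%:C *: canti J v y.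
Proof. by rewrite !cantiE !(JE hJ) !clmE; lmod. Qed.

Lemma smooth_chol X s : smooth_vf U X -> smooth_sec U s ->
  smooth_sec U (fun q => chol J (X q) (s q)).
Proof.
move=> sX ss; apply: (@eq_smooth_sec _ _ _ E _
  (fun q => r%:C *: (clm (X q) (s q) - 'i *: clm (J q (X q)) (s q)))) => //.
  by move=> q Uq; rewrite cholE.
apply: smooth_secZ => //; apply: smooth_secB => //; first exact: smooth_clm.
by apply: smooth_secZ => //; apply: smooth_clm => //; exact: rsmooth.
Qed.

Lemma smooth_canti X s : smooth_vf U X -> smooth_sec U s ->
  smooth_sec U (fun q => canti J (X q) (s q)).
Proof.
move=> sX ss; apply: (@eq_smooth_sec _ _ _ E _
  (fun q => r%:C *: (clm (X q) (s q) + 'i *: clm (J q (X q)) (s q)))) => //.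
  by move=> q Uq; rewrite cantiE.
apply: smooth_secZ => //; apply: smooth_secD => //; first exact: smooth_clm.
by apply: smooth_secZ => //; apply: smooth_clm => //; exact: rsmooth.
Qed.

Let conn_chol X Y s p : U p -> smooth_vf U X -> smooth_vf U Y -> smooth_sec U s ->
  cd_D (X p) (fun q => chol J (Y q) (s q)) =
  chol J (D p (X p) Y) (s p) + chol J (Y p) (cd_D (X p) s).
Proof.
move=> Up sX sY ss; have sJY := rsmooth sY.
have s1 := smooth_clm oU sY ss; have s2 := smooth_clm oU sJY ss.
have s3 := smooth_secZ 'i oU s2.
transitivity (cd_D (X p) (fun q =>
    r%:C *: (clm (Y q) (s q) + - 1 *: ('i *: clm (J q (Y q)) (s q))))).
  apply: (sec_eq hE oU) => //; first exact: smooth_chol.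
  by move=> q Uq; rewrite cholE scaleN1r.
rewrite (secZ hE oU)//; last by apply: smooth_secD => //; exact: smooth_secZ.
rewrite (secD hE oU)//; last exact: smooth_secZ.
rewrite !(secZ hE oU)// !(clm_parallel hDCl oU)// (conn_J hJ oU)// !cholE -/r.
by lmod.
Qed.

Let conn_canti X Y s p : U p -> smooth_vf U X -> smooth_vf U Y -> smooth_sec U s ->
  cd_D (X p) (fun q => canti J (Y q) (s q)) =
  canti J (D p (X p) Y) (s p) + canti J (Y p) (cd_D (X p) s).
Proof.
move=> Up sX sY ss; have sJY := rsmooth sY.
have s1 := smooth_clm oU sY ss; have s2 := smooth_clm oU sJY ss.
have s3 := smooth_secZ 'i oU s2.
transitivity (cd_D (X p) (fun q =>
    r%:C *: (clm (Y q) (s q) + ('i *: clm (J q (Y q)) (s q))))).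
  apply: (sec_eq hE oU) => //; first exact: smooth_canti.
  by move=> q Uq; rewrite cantiE.
rewrite (secZ hE oU)//; last by apply: smooth_secD.
rewrite (secD hE oU)//.
rewrite !(secZ hE oU)// !(clm_parallel hDCl oU)// (conn_J hJ oU)// !cantiE -/r.
by lmod.
Qed.

(** The vector with D_{z10 X} (z10 Y) = [z10 (holG X Y p)]. In [antG] the sign changes because [z01]
    turns [J] into -i. *)
Definition holG X Y p : tangent p := r *: (D p (X p) Y - J p (D p (J p (X p)) Y)).

Definition antG X Y p : tangent p := r *: (D p (X p) Y + J p (D p (J p (X p)) Y)).

Lemma cd_DC_chol X Y s p : U p -> smooth_vf U X -> smooth_vf U Y -> smooth_sec U s ->
  cd_DC (z10 J (X p)) (fun q => chol J (Y q) (s q)) =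
  chol J (holG X Y p) (s p) + chol J (Y p) (cd_DC (z10 J (X p)) s).
Proof.
move=> Up sX sY ss; have sJX := rsmooth sX.
rewrite !cd_DC_z10//; last exact: smooth_chol.
rewrite conn_chol// (conn_chol Up sJX sY ss) /holG cholZ (cholB hJ) chol_J.
rewrite [chol J (Y p) (_ *: _)]linearZ /= [chol J (Y p) (_ - _)]linearB.
by rewrite /= [chol J (Y p) (_ *: _)]linearZ /=; lmod.
Qed.

Lemma cd_DC_canti X Y s p : U p -> smooth_vf U X -> smooth_vf U Y -> smooth_sec U s ->
  cd_DC (z10 J (X p)) (fun q => canti J (Y q) (s q)) =
  canti J (antG X Y p) (s p) + canti J (Y p) (cd_DC (z10 J (X p)) s).
Proof.
move=> Up sX sY ss; have sJX := rsmooth sX.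
rewrite !cd_DC_z10//; last exact: smooth_canti.
rewrite conn_canti// (conn_canti Up sJX sY ss) /antG cantiZ (cantiD hJ) canti_J.
rewrite [canti J (Y p) (_ *: _)]linearZ /= [canti J (Y p) (_ - _)]linearB.
by rewrite /= [canti J (Y p) (_ *: _)]linearZ /=; lmod.
Qed.

(** The real and imaginary parts of [eps] are constant multiples of frame fields or their images
    under [J], but only on [U]; hence the local form of the hypotheses. *)
Lemma torsionZ (a b : R) X X' Y Y' p : U p -> smooth_vf U X -> smooth_vf U Y ->
  (forall q, U q -> X' q = a *: X q) -> (forall q, U q -> Y' q = b *: Y q) ->
  torsion D X' Y' p = (a * b) *: torsion D X Y p.
Proof.
move=> Up sX sY eX eY; have sa := smooth_vfZ a sX; have sb := smooth_vfZ b sY.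
rewrite -(eq_torsion hD oU (X := fun q => a *: X q) (Y := fun q => b *: Y q))//;
  [|by move=> q Uq; rewrite ?eX ?eY..].
rewrite (torsionMl hD oU Up (smooth_on_cst U a))// (torsionC D oU)//.
rewrite (torsionMl hD oU Up (smooth_on_cst U b))// (torsionC D oU Up sX sY).
by lmod.
Qed.

Lemma bracketZ (a b : R) X X' Y Y' p : U p -> smooth_vf U X -> smooth_vf U Y ->
  (forall q, U q -> X' q = a *: X q) -> (forall q, U q -> Y' q = b *: Y q) ->
  bracket X' Y' p = (a * b) *: bracket X Y p.
Proof.
move=> Up sX sY eX eY; have sa := smooth_vfZ a sX; have sb := smooth_vfZ b sY.
rewrite -(eq_bracket (X := fun q => a *: X q) (Y := fun q => b *: Y q) oU Up)//;
  [|by move=> q Uq; rewrite ?eX ?eY..].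
rewrite (bracketMr oU Up sa sY (smooth_on_cst U b)) (bracketC oU Up sa sY).
rewrite (bracketMr oU Up sY sX (smooth_on_cst U a)) (bracketC oU Up sX sY).
by rewrite !tangent_cst; lmod.
Qed.

Lemma curvatureZ (a b : R) X X' Y Y' s p : U p -> smooth_vf U X -> smooth_vf U Y ->
  smooth_sec U s ->
  (forall q, U q -> X' q = a *: X q) -> (forall q, U q -> Y' q = b *: Y q) ->
  curvature X' Y' s p = (a%:C * b%:C) *: curvature X Y s p.
Proof.
move=> Up sX sY ss eX eY; rewrite /curvature.
have sB := smooth_bracket oU sX sY.
rewrite (bracketZ Up sX sY eX eY) (sec_dirZ hE oU)//.
have E1 (A A' : vfield M) (c : R) (v : tangent p) : smooth_vf U A ->
    (forall q, U q -> A' q = c *: A q) ->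
    cd_D v (fun q => cd_D (A' q) s) = c%:C *: cd_D v (fun q => cd_D (A q) s).
  move=> sA eA; have sDA := smooth_sec_conn hE oU sA ss.
  rewrite -(secZ hE oU)//; apply/esym; apply: (sec_eq hE oU) => //.
    exact: smooth_secZ.
  by move=> q Uq; rewrite eA// (sec_dirZ hE oU).
rewrite (E1 Y Y' b)// (E1 X X' a)// eX// eY// !(sec_dirZ hE oU)//;
  try exact: (smooth_sec_conn hE oU).
by rewrite rmorphM; lmod.
Qed.

(** By bilinearity for [J] the four real torsions add up to 2 r^2 (T - iJT), which is 2 r [z10 T],
    and 2 r is [Num.sqrt 2]. *)
Lemma ctorsion_z10 (Z W : cvfield) X Y p : U p -> smooth_vf U X -> smooth_vf U Y ->
  (forall q, U q -> Z q = z10 J (X q)) -> (forall q, U q -> W q = z10 J (Y q)) ->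
  ctorsion D Z W p = z10 J (Num.sqrt 2 *: torsion D X Y p).
Proof.
move=> Up sX sY eZ eW; have sJX := rsmooth sX; have sJY := rsmooth sY.
have rZ q : U q -> re_vf Z q = r *: X q by move=> Uq; rewrite /re_vf eZ.
have iZ q : U q -> im_vf Z q = - r *: J q (X q).
  by move=> Uq; rewrite /im_vf eZ// /z10 /= scalerN scaleNr.
have rW q : U q -> re_vf W q = r *: Y q by move=> Uq; rewrite /re_vf eW.
have iW q : U q -> im_vf W q = - r *: J q (Y q).
  by move=> Uq; rewrite /im_vf eW// /z10 /= scalerN scaleNr.
have r2 : r * Num.sqrt 2 = 1 by rewrite mulVf// sqrtr_eq0 -ltNge ltr0n.
rewrite /ctorsion (torsionZ Up sX sY rZ rW) (torsionZ Up sJX sJY iZ iW).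
rewrite (torsionZ Up sX sJY rZ iW) (torsionZ Up sJX sY iZ rW).
rewrite !(torsion_Jl hJ oU)// !(torsion_Jr hJ oU)// !mulNr !mulrN rr.
rewrite /z10; congr pair; rewrite /= -/r !(JE hJ) ?scalerN scalerA r2.
  by lmod_coefs; field.
by lmod_coefs; field.
Qed.

(** The imaginary part of the complex bracket is governed by [JX, Y] + [X, JY] = J([X, Y] -
    [JX, JY]), that is, by integrability: the bracket is again of type (1,0). *)
Lemma ccurvature_z10 (Z W : cvfield) X Y s p : U p ->
  smooth_vf U X -> smooth_vf U Y -> smooth_sec U s ->
  (forall q, U q -> Z q = z10 J (X q)) -> (forall q, U q -> W q = z10 J (Y q)) ->
  ccurvature Z W s p =
    cd_DC (z10 J (X p)) (fun q => cd_DC (z10 J (Y q)) s)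
    - cd_DC (z10 J (Y p)) (fun q => cd_DC (z10 J (X q)) s)
    - cd_DC (z10 J (r *: (bracket X Y p - bracket (j X) (j Y) p))) s.
Proof.
move=> Up sX sY ss eZ eW; have sJX := rsmooth sX; have sJY := rsmooth sY.
have rZ q : U q -> re_vf Z q = r *: X q by move=> Uq; rewrite /re_vf eZ.
have iZ q : U q -> im_vf Z q = - r *: J q (X q).
  by move=> Uq; rewrite /im_vf eZ// /z10 /= scalerN scaleNr.
have rW q : U q -> re_vf W q = r *: Y q by move=> Uq; rewrite /re_vf eW.
have iW q : U q -> im_vf W q = - r *: J q (Y q).
  by move=> Uq; rewrite /im_vf eW// /z10 /= scalerN scaleNr.
rewrite /ccurvature (curvatureZ Up sX sY ss rZ rW) (curvatureZ Up sJX sJY ss iZ iW).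
rewrite (curvatureZ Up sX sJY ss rZ iW) (curvatureZ Up sJX sY ss iZ rW).
have sD (A : vfield M) : smooth_vf U A -> smooth_sec U (fun q => cd_D (A q) s).
  by move=> sA; exact: (smooth_sec_conn hE oU).
have DD (A B : vfield M) : smooth_vf U A -> smooth_vf U B ->
    cd_DC (z10 J (A p)) (fun q => cd_DC (z10 J (B q)) s) =
    r%:C *: (r%:C *: (cd_D (A p) (fun q => cd_D (B q) s)
        - 'i *: cd_D (A p) (fun q => cd_D (J q (B q)) s)
      - 'i *: (cd_D (J p (A p)) (fun q => cd_D (B q) s)
        - 'i *: cd_D (J p (A p)) (fun q => cd_D (J q (B q)) s)))).
  move=> sA sB; have sJB := rsmooth sB.
  have s1 := sD _ sB; have s2 := smooth_secZ 'i oU (sD _ sJB).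
  have s3 := smooth_secB oU s1 s2.
  rewrite cd_DC_z10//; last exact: smooth_cd_DC.
  have e (v : tangent p) : cd_D v (fun q => cd_DC (z10 J (B q)) s) =
      r%:C *: (cd_D v (fun q => cd_D (B q) s)
        - 'i *: cd_D v (fun q => cd_D (J q (B q)) s)).
    have s4 := smooth_secZ (-1) oU s2.
    have s5 := smooth_secD oU s1 s4.
    transitivity (cd_D v (fun q => r%:C *: (cd_D (B q) s
        + - 1 *: ('i *: cd_D (J q (B q)) s)))).
      apply: (sec_eq hE oU) => //; first exact: smooth_cd_DC.
      by move=> q Uq; rewrite cd_DC_z10// scaleN1r.
    rewrite (secZ hE oU)// (secD hE oU)// !(secZ hE oU)//; last exact: sD.
    by rewrite scaleN1r.
  by rewrite !e; lmod.
rewrite !DD// [X in _ = _ - X]cd_DC_z10// /curvature.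
have -> : J p (r *: (bracket X Y p - bracket (j X) (j Y) p)) =
    r *: (bracket (j X) Y p + bracket X (j Y) p).
  by rewrite (bracket_JJ hJ oU)// !(JE hJ); lmod.
rewrite !(sec_dirZ hE oU)// !(sec_dirD hE oU)// (sec_dirN hE oU)//.
rewrite rmorphN.
by lmod_coefs; ring: ii.
Qed.

End CovariantDerivative.

Lemma half_sum (C : numFieldType) (S : lmodType C) (n : nat)
    (F : 'I_n -> 'I_n -> S) :
  (forall j k, F j k = F k j) -> (forall j, F j j = 0) ->
  \sum_(j < n) \sum_(k < n | (j < k)%N) F j k = 2^-1 *: \sum_j \sum_k F j k.
Proof.
move=> sF F0; set u := (LHS).
have uE : u = \sum_(j < n) \sum_(k < n | (k < j)%N) F j k.
  rewrite /u (exchange_big_dep xpredT)//; apply: eq_bigr => j _.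
  by apply: eq_bigr => k _.
have -> : \sum_j \sum_k F j k = u + u.
  rewrite {2}uE /u -big_split; apply: eq_bigr => j _ /=.
  rewrite (bigID (fun k : 'I_n => (j < k)%N)) /=; congr (_ + _).
  rewrite (bigID (fun k : 'I_n => k == j)) /= big1 ?add0r; last first.
    by move=> k /andP[_ /eqP ->].
  by apply: eq_bigl => k; rewrite -val_eqE /=; case: ltngtP.
by lmod_coefs; field.
Qed.

(** * The operator of a structure [J]: frame independence and square *)

Section DiracSquare.
Context {R : realType} {n : nat} {M : hermitian_manifold R n}.
Context {Cl : clifford_bundle M} {DCl : cl_connection Cl}.
Variables (E : chern_dirac_bundle DCl) (D : tconnection M).
Variables (J : forall p : M, tangent p -> tangent p).
Arguments D : clear implicits.
Arguments J : clear implicits.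
Hypotheses (hJ : hermitian_structure D J) (hDCl : is_induced D DCl).
Implicit Types (p : M) (X Y : vfield M) (s t : section E) (e : frame M) (U V : set M).

Local Open Scope complex_scope.
Local Notation hD := (hs_conn hJ).
Local Notation "'j' X" := (fun q => J q (X q)) (at level 10, X at level 9).

Let r : R := (Num.sqrt 2)^-1.

Let r2 : r * 2 = Num.sqrt 2.
Proof. by rewrite -[2 in LHS](@sqr_sqrtr _ 2)// expr2 mulKf// sqrtr_eq0 -ltNge ltr0n. Qed.

Let r2C : Num.sqrt 2 * r = 1.
Proof. by rewrite mulfV// sqrtr_eq0 -ltNge ltr0n. Qed.

Definition dirac_section (x : 'I_n -> vfield M) s : section E := fun q =>
  \sum_l canti J (x l q) (cd_DC (z10 J (x l q)) s)
  - 4^-1 *: \sum_k \sum_l canti J (x k q) (canti J (x l q)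
      (chol J (Num.sqrt 2 *: torsion D (x k) (x l) q) (s q))).

(** Relative to the given [J], so that it also makes sense for the opposite structure. *)
Record adapted_frame U e : Prop := AdaptedFrame {
  af_frame : complex_frame J U (fun l => e l false);
  af_J : forall q, U q -> forall l, e l true q = J q (e l false q) }.

Lemma complex_frame_sub U V x : V `<=` U -> complex_frame J U x -> complex_frame J V x.
Proof.
move=> VU [sx ox ogx spx]; split.
- by move=> l; exact: smooth_vf_sub (sx l).
- by move=> p /VU; exact: ox.
- by move=> p /VU; exact: ogx.
- by move=> p /VU; exact: spx.
Qed.

Let epsE U e l q : adapted_frame U e -> U q -> eps e l q = z10 J (e l false q).
Proof. by move=> he Uq; rewrite /eps (af_J he Uq). Qed.

Let eps_barE U e l q : adapted_frame U e -> U q -> eps_bar e l q = z01 J (e l false q).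
Proof. by move=> he Uq; rewrite /eps_bar (af_J he Uq). Qed.

Let canti_sq p (v : tangent p) (y : E p) : canti J v (canti J v y) = 0.
Proof.
have /eqP := cantiC hJ v v y.
by rewrite -subr_eq0 opprK -mulr2n -scaler_nat scaler_eq0 pnatr_eq0 /= => /eqP.
Qed.

Lemma dirac_frame_section U e s p : open U -> U p -> adapted_frame U e ->
  dirac_frame' D e s p = dirac_section (fun l => e l false) s p.
Proof.
move=> oU Up he; have sx := cf_smooth (af_frame he).
rewrite /dirac_frame' /dirac_section; congr (_ - _).
  apply: eq_bigr => l _.
  by rewrite (epsE _ he Up) (eps_barE _ he Up).
set F := fun k l => canti J (e k false p) (canti J (e l false p)
  (chol J (Num.sqrt 2 *: torsion D (e k false) (e l false) p) (s p))).
transitivity (2^-1 *: \sum_(k < n) \sum_(l < n | (k < l)%N) F k l).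
  congr (_ *: _); apply: eq_bigr => k _; apply: eq_bigr => l _.
  rewrite !cd_c_mul !(eps_barE _ he Up).
  by rewrite (ctorsion_z10 hJ oU Up (sx k) (sx l)) // => q Uq; exact: (epsE _ he Uq).
rewrite half_sum ?scalerA; first by congr (_ *: _); field.
  move=> k l; rewrite /F (cantiC hJ) (torsionC D oU)// scalerN.
  rewrite -(scaleN1r (Num.sqrt 2 *: _)) (cholZ hJ) rmorphN1 scaleN1r.
  by rewrite !linearN /= opprK.
by move=> k; rewrite /F canti_sq.
Qed.

Lemma smooth_dirac_section U x s : open U -> complex_frame J U x ->
  smooth_sec U s -> smooth_sec U (dirac_section x s).
Proof.
move=> oU hx ss; have sx := cf_smooth hx.
apply: smooth_secB => //.
  apply: (@smooth_sec_sum _ _ _ E) => // l; apply: (smooth_canti hJ oU) => //.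
  exact: (smooth_cd_DC hJ).
apply: smooth_secZ => //; apply: (@smooth_sec_sum _ _ _ E) => // k.
apply: (@smooth_sec_sum _ _ _ E) => // l; apply: (smooth_canti hJ oU) => //.
apply: (smooth_canti hJ oU) => //; apply: (smooth_chol hJ oU) => //.
by apply: smooth_vfZ; exact: (smooth_torsion hD oU).
Qed.

Lemma eq_dirac_section U x s t p : open U -> U p -> smooth_sec U s ->
  (forall q, U q -> s q = t q) -> dirac_section x s p = dirac_section x t p.
Proof.
move=> oU Up ss st; rewrite /dirac_section -st//; congr (_ - _).
by apply: eq_bigr => l _; congr (canti J _ _); exact: (eq_cd_DC oU).
Qed.

Section Frame.
Variables (U : set M) (x : 'I_n -> vfield M).
Hypotheses (oU : open U) (hx : complex_frame J U x).
Local Notation tt := (torsion_tensor D J x).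

Let sx l : smooth_vf U (x l).
Proof. exact: (cf_smooth hx). Qed.

Let tt_suml p (c : 'I_n -> R[i]) (v : 'I_n -> tangent p) w :
  tt (\sum_l hscale J (c l) (v l)) w = \sum_l hscale J (c l) (tt (v l) w).
Proof.
have t0 : tt (0 : tangent p) w = 0.
  apply: (addrI (tt (0 : tangent p) w)).
  by rewrite -torsion_tensorDl !addr0.
elim/big_rec2: _ => // l z1 z2 _ <-.
by rewrite torsion_tensorDl (torsion_tensor_hscale hJ).
Qed.

Let tt_sumr p (c : 'I_n -> R[i]) (v : 'I_n -> tangent p) w : U p ->
  tt w (\sum_l hscale J (c l) (v l)) = \sum_l hscale J (c l) (tt w (v l)).
Proof.
move=> Up; rewrite (torsion_tensorC hJ oU hx)// tt_suml -sumrN.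
apply: eq_bigr => l _; rewrite [in RHS](torsion_tensorC hJ oU hx)//.
by rewrite /hscale !(JE hJ); lmod.
Qed.

Let B p (y : E p) (v w : tangent p) : E p := chol J (Num.sqrt 2 *: tt v w) y.

Let B_suml p (y : E p) (c : 'I_n -> R[i]) (v : 'I_n -> tangent p) w :
  B y (\sum_l hscale J (c l) (v l)) w = \sum_l c l *: B y (v l) w.
Proof.
rewrite /B (cholZ hJ) tt_suml (chol_sum hJ) scaler_sumr; apply: eq_bigr => l _.
by rewrite [in RHS](cholZ hJ) !scalerA mulrC.
Qed.

Let B_sumr p (y : E p) (c : 'I_n -> R[i]) (v : 'I_n -> tangent p) w : U p ->
  B y w (\sum_l hscale J (c l) (v l)) = \sum_l c l *: B y w (v l).
Proof.
move=> Up; rewrite /B (cholZ hJ) tt_sumr// (chol_sum hJ) scaler_sumr; apply: eq_bigr => l _.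
by rewrite [in RHS](cholZ hJ) !scalerA mulrC.
Qed.

(** Both parts are sesquilinear traces: the first-order part once, the torsion part in each of its
    two indices. *)
Lemma dirac_section_independent x' s p : U p -> complex_frame J U x' ->
  smooth_sec U s -> dirac_section x s p = dirac_section x' s p.
Proof.
move=> Up hx' ss; rewrite /dirac_section; congr (_ - _ *: _).
  apply: (frame_trace_independent hJ (F := fun v w => canti J v (cd_DC (z10 J w) s)) hx hx' Up Up).
    by move=> c v w; exact: (canti_sum hJ).
  move=> c v w; rewrite (cd_DC_sum hJ oU)// linear_sum; apply: eq_bigr => l _.
  by rewrite linearZ.
(* The inner trace; it is already independent of the frame ([CE]) and complex linear in [v], so the
   outer sum is again a trace. *)
pose Cx v := \sum_l canti J (x l p) (B (s p) v (x l p)).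
have CE v : Cx v = \sum_l canti J (x' l p) (B (s p) v (x' l p)).
  apply: (frame_trace_independent hJ (F := fun u w => canti J u (B (s p) v w)) hx hx' Up Up).
    by move=> c u w; exact: (canti_sum hJ).
  move=> c u w; rewrite B_sumr// linear_sum; apply: eq_bigr => l _.
  by rewrite linearZ.
transitivity (\sum_k canti J (x k p) (Cx (x k p))).
  apply: eq_bigr => k _; rewrite linear_sum; apply: eq_bigr => l _.
  by rewrite (torsion_tensorE hJ oU hx Up (sx k) (sx l)).
transitivity (\sum_k canti J (x' k p) (Cx (x' k p))).
  apply: (frame_trace_independent hJ (F := fun v w => canti J v (Cx w)) hx hx' Up Up).
    by move=> c u w; exact: (canti_sum hJ).
  move=> c v w; have -> : Cx (\sum_l hscale J (c l) (v l)) = \sum_l c l *: Cx (v l).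
    rewrite /Cx; under [RHS]eq_bigr => k _ do rewrite scaler_sumr.
    rewrite exchange_big; apply: eq_bigr => l _; rewrite B_suml linear_sum.
    by apply: eq_bigr => k _; rewrite linearZ.
  by rewrite linear_sum; apply: eq_bigr => l _; rewrite linearZ.
apply: eq_bigr => k _; rewrite CE linear_sum; apply: eq_bigr => l _.
have sx' := cf_smooth hx'.
by rewrite (torsion_tensorE hJ oU hx Up (sx' k) (sx' l)).
Qed.

(** Derivatives of the constants g(x_k, x_l) and g(x_k, J x_l): the matrix of [D] in a unitary frame
    is skew-Hermitian. *)
Let conn_frame p (v : tangent p) k l : U p ->
  hmetric (D p v (x k)) (x l p) = - hmetric (D p v (x l)) (x k p) /\
  hmetric (D p v (x k)) (J p (x l p)) = hmetric (D p v (x l)) (J p (x k p)).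
Proof.
move=> Up; have cst (f : M -> R) a : (forall q, U q -> f q = a) -> v f = 0.
  move=> fa; rewrite -(tangent_cst v a); apply/esym.
  apply: (eq_tangent v oU Up); first by move=> q /fa.
  exact: smooth_near_cst.
split; apply/eqP; rewrite -subr_eq0; apply/eqP.
  have := hs_metric hJ oU Up (sx k) (sx l) v.
  rewrite (cst _ (k == l)%:R); last by move=> q Uq; rewrite (cf_orthonormal hx).
  by rewrite opprK (hmetric_sym (x k p)).
have := hs_metric hJ oU Up (sx k) (smooth_J hJ oU (sx l)) v.
rewrite (cst _ 0); last by move=> q Uq; rewrite (cf_orthogonal hx).
by rewrite (conn_J hJ oU)// (hmetric_sym (x k p)) (hmetric_Jl hJ).
Qed.

(** Conjugation turns the plus sign of [antG] into the minus sign of [holG]; this is what [aGE] asks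
    for in the fibre computation. *)
Let antG_hcoord p i k l : U p ->
  ((hcoord J x l (antG D J (x i) (x k) p))^*)%R = - hcoord J x k (holG D J (x i) (x l) p).
Proof.
move=> Up; have [m1 m2] := conn_frame (x i p) k l Up.
have [m3 m4] := conn_frame (J p (x i p)) k l Up.
rewrite /hcoord /antG /holG -/r !hmetricE !(hmetric_Jl hJ) !(JE hJ) !hmetricE m1 m2 m3 m4.
by apply/eqP; rewrite eq_complex /=; apply/andP; split; apply/eqP; ring.
Qed.

Lemma dirac_section_square s p : U p -> smooth_sec U s ->
  dirac_section x (dirac_section x s) p =
  2^-1 *: \sum_i \sum_k canti J (x i p) (canti J (x k p)
    (cd_DC (z10 J (x i p)) (fun q => cd_DC (z10 J (x k q)) s)
     - cd_DC (z10 J (x k p)) (fun q => cd_DC (z10 J (x i q)) s)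
     - cd_DC (z10 J (r *: (bracket (x i) (x k) p - bracket (j (x i)) (j (x k)) p))) s)).
Proof.
move=> Up ss.
pose tau k l : vfield M := fun q => Num.sqrt 2 *: torsion D (x k) (x l) q.
have stau k l : smooth_vf U (tau k l).
  by apply: smooth_vfZ; exact: (smooth_torsion hD oU).
have tauE k l : tau k l p = Num.sqrt 2 *: tt (x k p) (x l p).
  by rewrite /tau (torsion_tensorE hJ oU hx).
pose H i k := cd_DC (z10 J (x i p)) (fun q => cd_DC (z10 J (x k q)) s).
pose Bf i k := r *: (bracket (x i) (x k) p - bracket (j (x i)) (j (x k)) p).
rewrite -(dirac_square_fibre (x := fun i => x i p) (phi := fun i v => hcoord J x i v)
  (T := fun v w => Num.sqrt 2 *: tt v w) (a := fun i => canti_l E J (x i p))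
  (b := fun v => chol_l E J v) (d := fun v => cd_DC (z10 J v) s)
  (G := fun i k => holG D J (x i) (x k) p) (B := Bf)
  (aG := fun i k => canti J (antG D J (x i) (x k) p))
  (DT := fun i k l => holG D J (x i) (tau k l) p) H (s p)).
- have sN k := smooth_cd_DC hJ oU (sx k) ss.
  have scN k := smooth_canti hJ oU (sx k) (sN k).
  have st k l := smooth_chol hJ oU (stau k l) ss.
  have sct k l := smooth_canti hJ oU (sx l) (st k l).
  have scct k l := smooth_canti hJ oU (sx k) (sct k l).
  have scs k := @smooth_sec_sum _ _ _ E U _ (index_enum 'I_n) _ oU (scct k).
  have sss := @smooth_sec_sum _ _ _ E U _ (index_enum 'I_n) _ oU scs.
  have sN' := @smooth_sec_sum _ _ _ E U _ (index_enum 'I_n) _ oU scN.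
  have sZ := smooth_secZ 4^-1 oU sss.
  (* The product rule through every Clifford factor; this brings the square to the left-hand side of
     [dirac_square_fibre]. *)
  have dE i : cd_DC (z10 J (x i p)) (dirac_section x s) =
      \sum_k (canti J (antG D J (x i) (x k) p) (cd_DC (z10 J (x k p)) s)
              + canti J (x k p) (H i k))
      - 4^-1 *: \sum_q \sum_l
      (canti J (antG D J (x i) (x q) p) (canti J (x l p) (chol J (tau q l p) (s p)))
       + canti J (x q p) (canti J (antG D J (x i) (x l) p) (chol J (tau q l p) (s p)))
       + canti J (x q p) (canti J (x l p) (chol J (holG D J (x i) (tau q l) p) (s p)))
       + canti J (x q p) (canti J (x l p) (chol J (tau q l p) (cd_DC (z10 J (x i p)) s)))).
    rewrite (cd_DC_secB oU (z10 J (x i p)) Up sN' sZ); congr (_ - _).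
      rewrite (cd_DC_sec_sum oU)//; apply: eq_bigr => k _.
      exact: (cd_DC_canti hJ hDCl oU).
    rewrite (cd_DC_secZ oU)//; congr (_ *: _).
    rewrite (cd_DC_sec_sum oU)//; apply: eq_bigr => q _.
    rewrite (cd_DC_sec_sum oU)//; apply: eq_bigr => l _.
    rewrite (cd_DC_canti hJ hDCl oU)// (cd_DC_canti hJ hDCl oU)//.
    by rewrite (cd_DC_chol hJ hDCl oU)// !linearD /= !addrA.
  rewrite /dirac_section; congr (_ - _).
    apply: eq_bigr => i _; rewrite dE; congr (canti J _ (_ - _ *: _)).
    by apply: eq_bigr => q _; apply: eq_bigr => l _; rewrite tauE.
  congr (_ *: _); apply: eq_bigr => k _; apply: eq_bigr => l _.
  rewrite -/(tau k l p) tauE; congr (canti J _ (canti J _ (chol J _ (_ - _ *: _)))).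
  by apply: eq_bigr => q _; apply: eq_bigr => u _; rewrite -/(tau q u p) tauE.
- by move=> u v w; rewrite torsion_tensorDl torsion_tensorNl; lmod.
- by move=> v w; rewrite (torsion_tensorC hJ oU hx)// scalerN.
- by move=> u v z; exact: (cholB hJ).
- by move=> u v; rewrite (cd_DC_D hJ oU)// (cd_DC_N hJ oU).
- by move=> i k z; exact: (cantiC hJ).
- by move=> v w z; exact: (cholC hJ).
- by move=> i v z; exact: (chol_canti hJ).
- move=> i k z; rewrite [in LHS](frame_expand hJ hx (antG _ _ _ _ _) Up) (canti_sum hJ) -sumrN.
  by apply: eq_bigr => l _; rewrite antG_hcoord// scaleNr.
- move=> v w z; rewrite [in RHS](frame_expand hJ hx v Up).
  exact/esym/(B_suml z).
- by move=> v; rewrite [in RHS](frame_expand hJ hx v Up) (cd_DC_sum hJ oU).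
(* As sqrt 2 = 2 r and T(JX, JY) = -T(X, Y), the scaled torsion is r (T(X, Y) - T(JX, JY)), whose
   terms are exactly those of [holG] and [Bf]. *)
- move=> i k; rewrite -tauE /tau /holG /Bf -/r -r2.
  have Tr : torsion D (j (x i)) (j (x k)) p = - torsion D (x i) (x k) p.
    have sJ := smooth_J hJ oU (sx k).
    by rewrite (torsion_Jl hJ oU Up (sx i) sJ) (torsion_Jr hJ oU Up (sx i) (sx k)) (JJ hJ).
  have -> : (r * 2) *: torsion D (x i) (x k) p =
      r *: (torsion D (x i) (x k) p - torsion D (j (x i)) (j (x k)) p).
    by rewrite Tr; lmod.
  rewrite /torsion !(conn_J hJ oU)//; lmod.
- move=> i k l.
  (* In [E1] and [E2] the factor [Num.sqrt 2] of the torsion meets the [r] of the bracket or of the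
     direction; their product is 1. *)
  have E1 a b c : Num.sqrt 2 *: tt (x c p) (Bf a b) =
      torsion D (x c) (fun q => bracket (x a) (x b) q - bracket (j (x a)) (j (x b)) q) p.
    have sb := smooth_bracket oU (sx a) (sx b).
    have sjb := smooth_bracket oU (smooth_J hJ oU (sx a)) (smooth_J hJ oU (sx b)).
    rewrite (torsion_tensorE hJ oU hx Up (sx c) (smooth_vfB sb sjb)).
    rewrite (torsion_tensorC hJ oU hx)// [in RHS](torsion_tensorC hJ oU hx)//.
    rewrite /Bf (_ : r *: _ =
      hscale J (r%:C) (bracket (x a) (x b) p - bracket (j (x a)) (j (x b)) p)).
      rewrite (torsion_tensor_hscale hJ) /hscale /= scale0r addr0 scalerN scalerA.
      by rewrite r2C scale1r.
    by rewrite /hscale /= scale0r addr0.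
  have E2 a b c : holG D J (x a) (tau b c) p =
      D p (x a p) (torsion D (x b) (x c)) - J p (D p (J p (x a p)) (torsion D (x b) (x c))).
    have sT := smooth_torsion hD oU (sx b) (sx c).
    rewrite /holG /tau !(conn_vfZ hD oU)// !(JE hJ) -/r -scalerBr scalerA.
    by rewrite mulrC r2C scale1r.
  rewrite !E1 !E2.
  have := first_bianchi_20 hJ oU Up (sx i) (sx k) (sx l).
  by move=> b20; rewrite -[RHS]b20; lmod.
Qed.

Lemma R20_section e s p : adapted_frame U e -> (forall l, e l false = x l) -> U p ->
  smooth_sec U s -> R20 e s p = dirac_section x (dirac_section x s) p.
Proof.
move=> he ex Up ss; rewrite dirac_section_square// -half_sum.
- apply: eq_bigr => i _; apply: eq_bigr => k _.
  rewrite !(eps_barE _ he Up) !ex cd_c_mul.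
  by rewrite (ccurvature_z10 hJ oU Up (sx i) (sx k) ss)// => q Uq; rewrite (epsE _ he Uq) ex.
(* Both the Clifford product and the curvature change sign, so the summand is symmetric, as
   [half_sum] requires. *)
- move=> i k; rewrite (cantiC hJ) -!linearN /=; congr (canti J _ (canti J _ _)).
  have -> : r *: (bracket (x i) (x k) p - bracket (j (x i)) (j (x k)) p) =
      - (r *: (bracket (x k) (x i) p - bracket (j (x k)) (j (x i)) p)).
    rewrite (bracketC oU Up (sx i) (sx k)).
    rewrite (bracketC oU Up (smooth_J hJ oU (sx i)) (smooth_J hJ oU (sx k))).
    by lmod.
  by rewrite (cd_DC_N hJ oU _ Up ss); lmod.
- by move=> i; rewrite canti_sq.
Qed.

End Frame.
Lemma dirac_frame_independent U U' V e e' s p : open U -> open U' -> open V ->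
  U p -> U' p -> V p -> adapted_frame U e -> adapted_frame U' e' ->
  smooth_sec V s -> dirac_frame' D e s p = dirac_frame' D e' s p.
Proof.
move=> oU oU' oV Up Up' Vp he he' ss.
rewrite (dirac_frame_section _ oU Up he) (dirac_frame_section _ oU' Up' he').
have oW : open (U `&` U' `&` V) by apply: openI => //; exact: openI.
apply: (dirac_section_independent oW) => //.
- by apply: complex_frame_sub (af_frame he) => q [[]].
- by apply: complex_frame_sub (af_frame he') => q [[]].
- by apply: smooth_sec_sub ss => q [].
Qed.

Lemma dirac_frame_square U U' e e' s t p : open U -> open U' -> U p -> U' p ->
  adapted_frame U e -> adapted_frame U' e' -> smooth_sec U s ->
  (forall q, U q -> t q = dirac_frame' D e s q) ->
  dirac_frame' D e' t p = R20 e s p.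
Proof.
move=> oU oU' Up Up' he he' ss tE.
have hx := af_frame he; have sd := smooth_dirac_section oU hx ss.
have dt q : U q -> dirac_section (fun l => e l false) s q = t q.
  by move=> Uq; rewrite tE// (dirac_frame_section _ oU Uq he).
have st : smooth_sec U t by exact: eq_smooth_sec sd.
rewrite (dirac_frame_independent oU' oU oU Up' Up Up he' he st).
rewrite (dirac_frame_section _ oU Up he) -(eq_dirac_section _ oU Up sd dt).
by rewrite (R20_section oU hx he).
Qed.

End DiracSquare.

(** * Passage from [J] to [- J] and the globally defined operators *)

Section TwoStructures.
Context {R : realType} {n : nat} {M : hermitian_manifold R n}.
Implicit Types (U : set M) (e : frame M).

Let J1 (p : M) (v : tangent p) : tangent p := hJ v.
Let J2 (p : M) (v : tangent p) : tangent p := - J1 v.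

Lemma chern_hermitian_structure (D : tconnection M) :
  is_chern D -> hermitian_structure D J1.
Proof.
move=> [cD cg cJ cT]; split=> //.
- exact: hJ_lin.
- exact: hJ_sq.
- exact: hJ_smooth.
- exact: hJ_integrable.
- exact: hmetric_J.
Qed.

(** Each condition involving [J] is quadratic in it or odd on both sides, so the same [D] serves the
    opposite structure. *)
Lemma hermitian_structureN (D : tconnection M) :
  hermitian_structure D J1 -> hermitian_structure D J2.
Proof.
move=> hJ; have hD := hs_conn hJ; split=> //.
- by move=> p a v w; rewrite /J2 (hs_lin hJ); lmod.
- by move=> p v; rewrite /J2 (JN hJ) opprK (JJ hJ).
- by move=> U X oU sX; apply: smooth_vfN; exact: (hs_smooth hJ).
- move=> U X Y p oU Up sX sY; have sJX := smooth_J hJ oU sX; have sJY := smooth_J hJ oU sY.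
  have sNX := smooth_vfN sJX; have sNY := smooth_vfN sJY.
  have e1 : bracket (fun q => J2 (X q)) Y p = - bracket (fun q => J1 (X q)) Y p.
    by rewrite (bracketC oU Up sNX sY) (bracketNr oU)// (bracketC oU Up sJX sY).
  have e2 : bracket X (fun q => J2 (Y q)) p = - bracket X (fun q => J1 (Y q)) p.
    by rewrite (bracketNr oU).
  have e3 : bracket (fun q => J2 (X q)) (fun q => J2 (Y q)) p =
      bracket (fun q => J1 (X q)) (fun q => J1 (Y q)) p.
    by rewrite (bracketNr oU)// (bracketC oU Up sNX sJY) (bracketNr oU)//
      (bracketC oU Up sJX sJY) !opprK.
  rewrite e1 e2 e3 /J2 !(JN hJ) !opprK.
  exact: (hs_integrable hJ oU Up sX sY).
- by move=> p v w; rewrite /J2 hmetricNl hmetricNr opprK (hs_isometry hJ).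
- by move=> U X Y p oU Up sX sY v; exact: (hs_metric hJ oU).
- move=> U X p oU Up sX v.
  by rewrite /J2 (conn_vfN hD oU)//; [rewrite (conn_J hJ oU)|exact: (smooth_J hJ)].
- move=> U X Y p oU Up sX sY; have sJX := smooth_J hJ oU sX; have sJY := smooth_J hJ oU sY.
  rewrite (torsionNl hD oU)// (torsionC D oU Up sX (smooth_vfN sJY)) (torsionNl hD oU)//.
  by rewrite (hs_torsion hJ oU Up sX sY) (torsionC D oU Up sX sJY).
Qed.

(** Changing the sign of the even members adapts the frame to [J2] and exchanges [eps] with
    [eps_bar]. *)
Let conj_frame e : frame M := fun l b => if b then fun q => - e l true q else e l false.

Lemma unitary_adapted U e : unitary_frame U e -> adapted_frame J1 U e.
Proof.
move=> [se oe spe Je]; split; last by move=> q Uq l; rewrite /J1 Je.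
split.
- by move=> l; exact: se.
- by move=> p Up l k; rewrite oe// andbT.
- by move=> p Up l k; rewrite /J1 Je// oe// andbF.
- move=> p Up v; have [a ->] := spe p Up v.
  exists (fun l => a l false), (fun l => a l true); apply: eq_bigr => l _.
  by rewrite big_bool /= /J1 Je// addrC.
Qed.

Lemma adapted_conj U e : adapted_frame J1 U e -> adapted_frame J2 U (conj_frame e).
Proof.
move=> [[sx ox ogx spx] Je]; split; last by move=> q Uq l; rewrite /= Je.
split=> //.
- by move=> p Up l k; rewrite /J2 hmetricNr [X in - X]ogx ?oppr0.
- move=> p Up v; have [a [b ->]] := spx p Up v.
  exists a, (fun l => - b l); apply: eq_bigr => l _.
  by rewrite /J2 /=; lmod.
Qed.

Let eps_conj e : eps (conj_frame e) = eps_bar e.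
Proof.
apply: functional_extensionality_dep => l.
by apply: functional_extensionality_dep => q; rewrite /eps /eps_bar /= opprK.
Qed.

Let eps_bar_conj e : eps_bar (conj_frame e) = eps e.
Proof. by []. Qed.

Context {Cl : clifford_bundle M} {DCl : cl_connection Cl}.
Variables (D : tconnection M) (E : chern_dirac_bundle DCl).
Hypotheses (hD : is_chern D) (hDCl : is_induced D DCl).
Implicit Types s t : section E.

Lemma dirac_frame''E e s : dirac_frame'' D e s = dirac_frame' D (conj_frame e) s.
Proof. by rewrite /dirac_frame'' /dirac_frame' eps_conj eps_bar_conj. Qed.

Lemma R02E e s : R02 e s = R20 (conj_frame e) s.
Proof. by rewrite /R02 /R20 eps_conj eps_bar_conj. Qed.

Let hs1 := chern_hermitian_structure hD.
Let hs2 := hermitian_structureN hs1.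

(** All unitary frames near [p] give the same value, so [xget] has no choice. *)
Lemma partial_dirac'E U V e s p : open U -> open V -> U p -> V p ->
  unitary_frame U e -> smooth_sec V s ->
  partial_dirac' D s p = dirac_frame' D e s p.
Proof.
move=> oU oV Up Vp ue ss; apply: xget_unique; first by exists U, e.
move=> _ [U' [e' [oU' Up' ue' ->]]]; apply/esym.
exact: (dirac_frame_independent hs1 oU oU' oV Up Up' Vp
  (unitary_adapted ue) (unitary_adapted ue')).
Qed.

Lemma partial_dirac''E U V e s p : open U -> open V -> U p -> V p ->
  unitary_frame U e -> smooth_sec V s ->
  partial_dirac'' D s p = dirac_frame'' D e s p.
Proof.
move=> oU oV Up Vp ue ss; apply: xget_unique; first by exists U, e.
move=> _ [U' [e' [oU' Up' ue' ->]]]; rewrite !dirac_frame''E; apply/esym.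
exact: (dirac_frame_independent hs2 oU oU' oV Up Up' Vp
  (adapted_conj (unitary_adapted ue)) (adapted_conj (unitary_adapted ue'))).
Qed.

Lemma partial_dirac'_square U e s p : open U -> U p -> unitary_frame U e ->
  smooth_sec setT s -> partial_dirac' D (partial_dirac' D s) p = R20 e s p.
Proof.
move=> oU Up ue ss; have ae := unitary_adapted ue.
have ssU : smooth_sec U s by exact: smooth_sec_sub ss.
have tE q : U q -> partial_dirac' D s q = dirac_frame' D e s q.
  by move=> Uq; exact: (partial_dirac'E oU openT Uq _ ue ss).
have sd := smooth_dirac_section hs1 oU (af_frame ae) ssU.
(* Without this the outer operator could not be computed in the frame [e]; it uses [tE] on all of
   [U], not just at [p]. *)
have st : smooth_sec U (partial_dirac' D s).
  apply: eq_smooth_sec sd => // q Uq.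
  by rewrite tE// (dirac_frame_section hs1 _ oU Uq ae).
rewrite (partial_dirac'E oU oU Up Up ue st).
exact: (dirac_frame_square hs1 hDCl oU oU Up Up ae ae ssU tE).
Qed.

Lemma partial_dirac''_square U e s p : open U -> U p -> unitary_frame U e ->
  smooth_sec setT s -> partial_dirac'' D (partial_dirac'' D s) p = R02 e s p.
Proof.
move=> oU Up ue ss; have ae := adapted_conj (unitary_adapted ue).
have ssU : smooth_sec U s by exact: smooth_sec_sub ss.
have tE q : U q -> partial_dirac'' D s q = dirac_frame' D (conj_frame e) s q.
  by move=> Uq; rewrite (partial_dirac''E oU openT Uq _ ue ss)// dirac_frame''E.
have sd := smooth_dirac_section hs2 oU (af_frame ae) ssU.
have st : smooth_sec U (partial_dirac'' D s).
  apply: eq_smooth_sec sd => // q Uq.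
  by rewrite tE// (dirac_frame_section hs2 _ oU Uq ae).
rewrite (partial_dirac''E oU oU Up Up ue st) dirac_frame''E R02E.
exact: (dirac_frame_square hs2 hDCl oU oU Up Up ae ae ssU tE).
Qed.

End TwoStructures.

Theorem theorem3p4 (R : realType) (n : nat) (M : hermitian_manifold R n)
    (D : tconnection M) (hD : is_chern D)
    (Cl : clifford_bundle M) (DCl : cl_connection Cl) (hDCl : is_induced D DCl)
    (E : chern_dirac_bundle DCl) (sigma : section E)
    (hsigma : smooth_sec [set: M] sigma)
    (U : set M) (hU : open U) (e : frame M) (he : unitary_frame U e)
    (p : M) (hp : U p) :
  partial_dirac' D (partial_dirac' D sigma) p = R20 e sigma p /\
  partial_dirac'' D (partial_dirac'' D sigma) p = R02 e sigma p.
Proof.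
by split; [exact: (partial_dirac'_square hD hDCl hU)
          |exact: (partial_dirac''_square hD hDCl hU)].
Qed.
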